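(* Let $1<p<\infty$ and let $T$ be a linear operator defined on scalar valued functions on $\mathbb{R}^d$ whose canonical vector-valued extension $T\otimes\mathbf{I}_n$ satisfies, for every $n\in\mathbb{N}$ and every $n\times n$ matrix $\mathrm{A}_p$ weight $W$, $$\|T\otimes\mathbf{I}_n\|_{L^p(W)\to L^p(W)}\le\phi_n([W]_{\mathrm{A}_p})$$ for some positive increasing function $\phi_n$ (possibly depending on $T,d,n$ and $p$). Let $m\in\mathbb{N}$, let $U,V$ be $m\times m$ matrix $\mathrm{A}_p$ weights and let $B$ be a locally integrable $m\times m$ matrix valued function. Then, with $\phi=\phi_{2m}$, $$\|[M_B,T\otimes\mathbf{I}_m]\|_{L^p(U)\to L^p(V)}\le\|B\|_{\widetilde{\mathrm{BMO}}^p_{V,U}}\;\phi\left(3^{\frac p{p'}}\left([U]_{\mathrm{A}_p}+[V]_{\mathrm{A}_p}\right)+1\right).$$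
   Context: $\frac1p+\frac1{p'}=1$. $\fint_Q$ denotes the unweighted average over $Q$. $\|\cdot\|$ on matrices is the operator norm induced by the Euclidean norm. An $n\times n$ matrix weight is a measurable $n\times n$ matrix valued function $W$ on $\mathbb{R}^d$ that is positive definite a.e. $L^p(W)$ is the space of $\mathbb{C}^n$ valued functions $\vec f$ with $\|\vec f\|_{L^p(W)}=\left(\int_{\mathbb{R}^d}|W^{1/p}(x)\vec f(x)|^p\,dx\right)^{1/p}<\infty$. $W$ is a matrix $\mathrm{A}_p$ weight if $$[W]_{\mathrm{A}_p}=\sup_{Q\text{ cube}}\fint_Q\left(\fint_Q\|W^{1/p}(x)W^{-1/p}(y)\|^{p'}\,dy\right)^{p/p'}dx<\infty.$$ $T\otimes\mathbf{I}_n$ acts on $\mathbb{C}^n$ valued functions by applying $T$ to each component; $M_B$ is pointwise multiplication by $B$; $[M_B,S]=M_BS-SM_B$. $\|\cdot\|_{L^p(U)\to L^p(V)}$ is the operator norm. Finally $$\|B\|_{\widetilde{\mathrm{BMO}}^p_{V,U}}^p=\sup_{Q\text{ cube}}\fint_Q\left(\fint_Q\|V^{1/p}(x)(B(x)-B(y))U^{-1/p}(y)\|^{p'}\,dy\right)^{p/p'}dx.$$ *)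

(* Defs.v *)
From HB Require Import structures.
From mathcomp Require Import all_boot all_order all_algebra.
From mathcomp Require Import complex.
From mathcomp Require Import all_classical all_reals all_analysis.

Set Implicit Arguments.
Unset Strict Implicit.
Unset Printing Implicit Defensive.

Import Order.TTheory GRing.Theory Num.Theory.
Import numFieldNormedType.Exports.

Local Open Scope classical_set_scope.
Local Open Scope ring_scope.

Section lebesgue_tuple.
Context {R : realType}.

Definition cons_pair (d : nat) (z : R * d.-tuple R) : d.+1.-tuple R :=
  [the d.+1.-tuple R of z.1 :: z.2].

Lemma measurable_cons_pair d : measurable_fun setT (@cons_pair d).
Proof. exact: measurable_cons. Qed.

Definition uncons (d : nat) (t : d.+1.-tuple R) : R * d.-tuple R :=
  (thead t, [tuple of behead t]).

Lemma measurable_uncons d : measurable_fun setT (@uncons d).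
Proof.
apply/measurable_fun_pair; first exact: measurable_tnth.
exact: measurable_behead.
Qed.

Lemma cons_pairK d : cancel (@cons_pair d) (@uncons d).
Proof.
case=> x t; rewrite /uncons /cons_pair; congr pair => //.
by apply/val_inj.
Qed.

Section step.
Variables (d : nat) (mu : {sigma_finite_measure set d.-tuple R -> \bar R}).

Definition lebesgue_step : set (d.+1.-tuple R) -> \bar R :=
  pushforward (@lebesgue_measure R \x mu)%E (@cons_pair d).

Let step0 : lebesgue_step set0 = 0%E.
Proof. by rewrite /lebesgue_step /pushforward preimage_set0 measure0. Qed.

Let step_ge0 A : (0 <= lebesgue_step A)%E.
Proof. by rewrite /lebesgue_step /pushforward; exact: measure_ge0. Qed.

Let measurable_preimage_cons (A : set (d.+1.-tuple R)) :
  measurable A -> measurable (@cons_pair d @^-1` A).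
Proof. by move=> mA; rewrite -[X in measurable X]setTI; exact: measurable_cons_pair. Qed.

Let step_sigma_additive : semi_sigma_additive lebesgue_step.
Proof.
move=> F mF tF mUF; rewrite /lebesgue_step /pushforward preimage_bigcup.
apply: measure_semi_sigma_additive.
- by move=> n; exact: measurable_preimage_cons.
- apply/trivIsetP => /= i j _ _ ij; rewrite -preimage_setI.
  by move/trivIsetP : tF => /(_ _ _ _ _ ij) ->//; rewrite preimage_set0.
- by rewrite -preimage_bigcup; exact: measurable_preimage_cons.
Qed.

HB.instance Definition _ := isMeasure.Build _ _ _
  lebesgue_step step0 step_ge0 step_sigma_additive.

Let step_sigma_finite : sigma_finite setT lebesgue_step.
Proof.
have /sigma_finiteP[F [TF ndF Foo]] := sigma_finiteT (@lebesgue_measure R).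
have /sigma_finiteP[G [TG ndG Goo]] := sigma_finiteT mu.
exists (fun n => @uncons d @^-1` (F n `*` G n)).
  rewrite -preimage_bigcup (_ : \bigcup_n _ = setT) ?preimage_setT//.
  rewrite -subTset => -[x y] _.
  have [n _ Fnx] : (\bigcup_n F n) x by rewrite -TF.
  have [k _ Gky] : (\bigcup_n G n) y by rewrite -TG.
  exists (maxn n k) => //; split => /=.
  - by move: x Fnx; exact/subsetPset/ndF/leq_maxl.
  - by move: y Gky; exact/subsetPset/ndG/leq_maxr.
move=> k; have [mF Fk] := Foo k; have [mG Gk] := Goo k; split.
  rewrite -[X in measurable X]setTI.
  by apply: measurable_uncons => //; exact: measurableX.
rewrite /lebesgue_step /pushforward -comp_preimage.
rewrite (_ : @uncons d \o @cons_pair d = id); last first.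
  by apply/funext => z; exact: cons_pairK.
by rewrite preimage_id product_measure1E// lte_mul_pinfty// ge0_fin_numE.
Qed.

HB.instance Definition _ := Measure_isSigmaFinite.Build _ _ _
  lebesgue_step step_sigma_finite.
End step.

Fixpoint lebesgue_tuple (d : nat) : {sigma_finite_measure set d.-tuple R -> \bar R} :=
  match d with
  | 0 => \d_ [tuple]
  | d'.+1 => lebesgue_step (lebesgue_tuple d')
  end.
End lebesgue_tuple.

Lemma lebesgue_tuple_box (R : realType) (d : nat) (a b : d.-tuple R) :
    (forall i, tnth a i <= tnth b i) ->
  lebesgue_tuple d [set x | forall i, tnth a i <= tnth x i <= tnth b i] =
  (\prod_(i < d) (tnth b i - tnth a i))%:E.
Proof.
elim: d a b => [a b _|d ih a b ab].
  rewrite big_ord0 [X in lebesgue_tuple _ X](_ : _ = setT).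
    exact: (@diracT _ _ _ [tuple]).
  by rewrite -subTset => x _ [].
pose a' := [tuple tnth a (lift ord0 i) | i < d].
pose b' := [tuple tnth b (lift ord0 i) | i < d].
pose A := [set` `[tnth a ord0, tnth b ord0]] : set R.
pose B := [set x : d.-tuple R | forall i, tnth a' i <= tnth x i <= tnth b' i].
rewrite /= /lebesgue_step /pushforward.
rewrite [X in (_ \x _)%E X](_ : _ = A `*` B); last first.
  apply/seteqP; split => -[x t] /=.
    move=> h; split; first by rewrite /A /= in_itv; exact: (h ord0).
    by move=> i; have := h (lift ord0 i); rewrite tnthS !tnth_mktuple.
  move=> [xA tB] i; have [j ->|->] := unliftP ord0 i.
    by have := tB j; rewrite tnthS !tnth_mktuple.
  by move: xA; rewrite /A /= in_itv.
have mB : measurable B.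
  have -> : B = \bigcap_i ((fun x : d.-tuple R => tnth x i) @^-1`
      [set` `[tnth a' i, tnth b' i]]).
    apply/seteqP; split => [x h i _|x h i] /=; first by rewrite in_itv; exact: h.
    by have := h i I; rewrite /= in_itv.
  apply: fin_bigcap_measurable => // i _.
  by rewrite -[X in measurable X]setTI; exact: measurable_tnth.
rewrite product_measure1E//; last exact: measurable_itv.
rewrite ih => [|i]; last by rewrite !tnth_mktuple.
rewrite big_ord_recl EFinM; congr (_ * _)%E; last first.
  by congr EFin; apply: eq_bigr => i _; rewrite !tnth_mktuple.
transitivity (@lebesgue_measure R A) => //.
rewrite /A lebesgue_measure_itv /= lte_fin.
have := ab ord0; rewrite le_eqVlt => /predU1P[->|->]; last by rewrite EFinB.
by rewrite ltxx subrr.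
Qed.

(* The d-dimensional Euclidean space with its Lebesgue sigma-algebra (the
   Caratheodory-measurable sets), as opposed to the Borel one of d.-tuple R *)
Definition Rn (R : realType) (d : nat) : measurableType _ :=
  caratheodory_type ((@lebesgue_tuple R d)^*)%mu.

Definition leb (R : realType) (d : nat) : set (Rn R d) -> \bar R :=
  @completed_measure_extension _ _ _ (@lebesgue_tuple R d).

HB.instance Definition _ (R : realType) (d : nat) := Measure.on (@leb R d).

HB.instance Definition _ (R : realType) (d : nat) :=
  @Measure_isSigmaFinite.Build _ _ _ (@leb R d)
    (completed_measure_extension_sigma_finite
      (sigma_finiteT (@lebesgue_tuple R d))).

Section cubes.
Context {R : realType} {d : nat}.
Implicit Types Q : set (Rn R d).

Definition cube (a : d.-tuple R) (l : R) : set (Rn R d) :=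
  [set x : d.-tuple R | forall i, tnth a i <= tnth x i <= tnth a i + l].

Definition cubes : set (set (Rn R d)) :=
  [set Q | exists a l, 0 < l /\ Q = cube a l].

Definition mean Q (f : Rn R d -> \bar R) : \bar R :=
  ((fine (leb Q))^-1%:E * \int[@leb R d]_(x in Q) f x)%E.
End cubes.

Section matrices.
Context {R : realType}.
Local Notation C := (R[i]%C).

Definition enorm n (v : 'cV[C]_n) : R :=
  Num.sqrt (\sum_i ComplexField.Normc.normc (v i ord0) ^+ 2).

Definition mxnorm k n (A : 'M[C]_(k, n)) : R :=
  sup [set enorm (A *m v) | v in [set v : 'cV[C]_n | enorm v <= 1]].

Definition posdefmx n (A : 'M[C]_n) : Prop :=
  A \is hermsymmx /\
  forall v : 'cV[C]_n, v != 0 -> 0 < (map_mx Num.conj v^T *m A *m v) ord0 ord0.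

(* A `^ s by functional calculus, meaningful for positive definite A: the
   spectral theorem gives A = P^-1 *m diag_mx l *m P with P := spectralmx A
   unitary and l := spectral_diag A, see orthomx_spectralP *)
Definition mxpowR n (A : 'M[C]_n) (s : R) : 'M[C]_n :=
  invmx (spectralmx A) *m
  diag_mx (map_mx (fun z => (complex.Re z `^ s)%:C%C) (spectral_diag A)) *m
  spectralmx A.
End matrices.

Section matrix_weights.
Context {R : realType} {d : nat}.
Local Notation C := (R[i]%C).
Local Notation X := (Rn R d).
Local Notation mu := (@leb R d).

Definition mx_measurable k n (A : X -> 'M[C]_(k, n)) : Prop :=
  forall i j, measurable_fun setT (fun x => complex.Re (A x i j)) /\
              measurable_fun setT (fun x => complex.Im (A x i j)).

(* Every compact set lies in a cube *)
Definition mx_locally_integrable k n (A : X -> 'M[C]_(k, n)) : Prop :=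
  mx_measurable A /\
  forall Q, cubes Q -> forall i j,
    mu.-integrable Q (EFin \o (fun x => complex.Re (A x i j))) /\
    mu.-integrable Q (EFin \o (fun x => complex.Im (A x i j))).

Definition matrix_weight n (W : X -> 'M[C]_n) : Prop :=
  mx_measurable W /\ {ae mu, forall x, posdefmx (W x)}.

(* p' is meant to be the conjugate exponent of p; W^(-1/p) is the power
   mxpowR W (- p^-1), which is defined where W is positive definite *)
Definition Ap_const (p p' : R) n (W : X -> 'M[C]_n) : \bar R :=
  ereal_sup [set mean Q (fun x =>
    (mean Q (fun y =>
       (mxnorm (mxpowR (W x) p^-1 *m mxpowR (W y) (- p^-1)) `^ p')%:E)
     `^ (p / p'))%E) | Q in cubes].

Definition Ap_weight (p p' : R) n (W : X -> 'M[C]_n) : Prop :=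
  matrix_weight W /\ (Ap_const p p' W < +oo)%E.

Definition BMO_norm (p p' : R) m (V U : X -> 'M[C]_m) (B : X -> 'M[C]_m) :
    \bar R :=
  (ereal_sup [set mean Q (fun x =>
    (mean Q (fun y =>
       (mxnorm (mxpowR (V x) p^-1 *m (B x - B y) *m mxpowR (U y) (- p^-1))
        `^ p')%:E)
     `^ (p / p'))%E) | Q in cubes] `^ p^-1)%E.

Definition Lp_norm (p : R) n (W : X -> 'M[C]_n) (f : X -> 'cV[C]_n) : \bar R :=
  ((\int[mu]_x (enorm (mxpowR (W x) p^-1 *m f x) `^ p)%:E) `^ p^-1)%E.

Definition Lp_space (p : R) n (W : X -> 'M[C]_n) : set (X -> 'cV[C]_n) :=
  [set f | mx_measurable f /\ (Lp_norm p W f < +oo)%E].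

(* The norm in [0, +oo] of an operator S, defined on dom, from L^p(U) to
   L^p(V); it is +oo if L^p(U) is not contained in dom *)
Definition Lp_opnorm (p : R) n (U V : X -> 'M[C]_n)
    (dom : set (X -> 'cV[C]_n)) (S : (X -> 'cV[C]_n) -> X -> 'cV[C]_n) :
    \bar R :=
  ereal_inf [set c%:E | c in [set c : R | 0 <= c /\
    forall f, Lp_space p U f ->
      [/\ dom f, Lp_space p V (S f) &
          (Lp_norm p V (S f) <= c%:E * Lp_norm p U f)%E]]].

(* Functions are identified when they agree almost everywhere, so linearity
   is required almost everywhere *)
Definition linear_operator (dom : set (X -> C)) (T : (X -> C) -> X -> C) : Prop :=
  dom (fun=> 0) /\
  forall (a : C) f g, dom f -> dom g ->
    dom (fun x => a * f x + g x) /\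
    {ae mu, forall x, T (fun x => a * f x + g x) x = a * T f x + T g x}.

Section extension.
Variables (n : nat) (dom : set (X -> C)) (T : (X -> C) -> X -> C).

(* The canonical extension of T, acting on each component *)
Definition vext (f : X -> 'cV[C]_n) (x : X) : 'cV[C]_n :=
  \col_i T (fun y => f y i ord0) x.

Definition vext_dom : set (X -> 'cV[C]_n) :=
  [set f | forall i, dom (fun y => f y i ord0)].
End extension.

Definition mulop n (B : X -> 'M[C]_n) (f : X -> 'cV[C]_n) (x : X) : 'cV[C]_n :=
  B x *m f x.

Section commutator.
Variables (n : nat) (B : X -> 'M[C]_n) (dom : set (X -> 'cV[C]_n)).
Variable S : (X -> 'cV[C]_n) -> X -> 'cV[C]_n.

Definition commutator (f : X -> 'cV[C]_n) (x : X) : 'cV[C]_n :=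
  mulop B (S f) x - S (mulop B f) x.

Definition commutator_dom : set (X -> 'cV[C]_n) :=
  [set f | dom f /\ dom (mulop B f)].
End commutator.

End matrix_weights.

(* Main.v *)
Require Import Defs.
From HB Require Import structures.
From mathcomp Require Import all_boot all_order all_algebra.
From mathcomp Require Import complex.
From mathcomp Require Import all_classical all_reals all_analysis.
From mathcomp Require Import measurable_realfun.
From mathcomp Require Import ring lra.

Set Implicit Arguments.
Unset Strict Implicit.
Unset Printing Implicit Defensive.

Import Order.TTheory GRing.Theory Num.Theory.
Import numFieldNormedType.Exports.

Local Open Scope classical_set_scope.
Local Open Scope ring_scope.

(** Why the theorem holds.  A triangular conjugation turns the commutator into an
    off-diagonal entry, so that a weighted bound for the vector extension of the
    operator on pairs of vectors contains a two-weight bound for the commutator.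

    For a number [lam > 0] put
      [Phi = [[V^{1/p}, - V^{1/p} B], [0, lam U^{1/p}]]] and
      [W = (Phi^* Phi)^{p/2}],
    a weight of size [2 m] with [|W^{1/p} v| = |Phi v|] ([enorm_gram_power]).  On
    the pair [F = (B f, f)] one has [Phi F = (0, lam U^{1/p} f)], while the first
    component of [Phi (T F)] is [- V^{1/p} [B, T] f].  Hence a bound [c] for [T] on
    [L^p(W)] gives the bound [c lam] for the commutator from [L^p(U)] to [L^p(V)]
    ([commutator_bound]).

    It remains to estimate the constant of [W].  The polar decomposition gives
      [||W^{1/p}(x) W^{-1/p}(y)|| <= ||Phi(x) Phi(y)^{-1}||]
    ([mxnorm_gram_power]), and the product on the right is again upper triangular
    ([triangular_product]): its diagonal blocks are the kernels that define the
    constants of [V] and [U], and its corner is the kernel of the oscillation of [B]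
    divided by [lam].  With [lam] at least the oscillation norm, the corner
    contributes at most [1] to the mixed average.  The three contributions are not
    added by the triangle inequality, which would cost a factor [3^{p-1}] on the
    summand [1]; the squared norm of a triangular block matrix is at most the sum
    of the squared norms of its blocks ([mxnorm_block_triangular]), which leads to
      [[W] <= max(1, 3^{p-2}) ([V] + 1 + [U])]
    ([mixed_mean_pythagoras]).  As [U] and [V] have constants at least [1]
    ([Ap_const_ge1]), this is below [3^{p-1} ([U] + [V]) + 1], and [p / p' = p - 1].

    Measurability of [W] rests on the fact that a power of a positive definite
    matrix is reached from its entries by sums, products and pointwise limits
    ([mxmeas_mxpowR_posdef]); the exceptional null sets are handled by the
    completeness of the Lebesgue measure. *)

(** * Euclidean and operator norms *)

Section euclidean_norm.
Context {R : realType}.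
Local Notation C := (R[i]%C).
Local Notation normc := (@ComplexField.Normc.normc R).

Lemma normc_sqr (z : C) : normc z ^+ 2 = complex.Re z ^+ 2 + complex.Im z ^+ 2.
Proof. by case: z => a b /=; rewrite sqr_sqrtr// addr_ge0// sqr_ge0. Qed.

Lemma normc_ge0 (z : C) : 0 <= normc z.
Proof. by case: z => a b; exact: sqrtr_ge0. Qed.

Lemma normc_real (a : R) : 0 <= a -> normc a%:C%C = a.
Proof. by move=> a0; rewrite /= expr0n addr0 sqrtr_sqr ger0_norm. Qed.

Lemma cauchy_schwarz_sum (I : finType) (x y : I -> R) :
  (\sum_i x i * y i) ^+ 2 <= (\sum_i x i ^+ 2) * (\sum_i y i ^+ 2).
Proof.
have e (a b : I -> R) : (\sum_i a i) * (\sum_i b i) = \sum_i \sum_j a i * b j.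
  by rewrite mulr_suml; apply: eq_bigr => i _; rewrite mulr_sumr.
rewrite expr2 !e -subr_ge0.
set S := \sum_i \sum_j x i ^+ 2 * y j ^+ 2.
have -> : S = 2^-1 * \sum_i \sum_j (x i ^+ 2 * y j ^+ 2 + x j ^+ 2 * y i ^+ 2).
  have -> : \sum_i \sum_j (x i ^+ 2 * y j ^+ 2 + x j ^+ 2 * y i ^+ 2) = S + S.
    rewrite {2}/S [X in _ = _ + X]exchange_big -big_split/=.
    by apply: eq_bigr => i _; rewrite -big_split.
  by lra.
rewrite mulr_sumr -sumrB sumr_ge0// => i _.
rewrite mulr_sumr -sumrB sumr_ge0// => j _.
have := sqr_ge0 (x i * y j - x j * y i); lra.
Qed.

Lemma enorm_ge0 n (v : 'cV[C]_n) : 0 <= enorm v.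
Proof. exact: sqrtr_ge0. Qed.

Lemma enorm_sqr n (v : 'cV[C]_n) : enorm v ^+ 2 = \sum_i normc (v i ord0) ^+ 2.
Proof. by rewrite sqr_sqrtr// sumr_ge0// => i _; rewrite sqr_ge0. Qed.

Lemma enorm0 n : enorm (0 : 'cV[C]_n) = 0.
Proof.
apply/eqP; rewrite -sqrf_eq0 enorm_sqr big1// => i _.
by rewrite mxE ComplexField.Normc.normc0 expr0n.
Qed.

Lemma enorm_gt0 n (v : 'cV[C]_n) : (0 < enorm v) = (v != 0).
Proof.
rewrite lt_neqAle enorm_ge0 andbT eq_sym; congr (~~ _).
apply/eqP/eqP => [v0|->]; last exact: enorm0.
have /psumr_eq0P h : \sum_i normc (v i ord0) ^+ 2 = 0.
  by rewrite -enorm_sqr v0 expr0n.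
apply/matrixP => i j; rewrite ord1 mxE; apply: ComplexField.Normc.eq0_normc.
by apply/eqP; rewrite -sqrf_eq0; apply/eqP/h => // k _; rewrite sqr_ge0.
Qed.

Lemma enormZ n (a : C) (v : 'cV[C]_n) : enorm (a *: v) = normc a * enorm v.
Proof.
apply/eqP; rewrite -(@eqrXn2 _ 2)// ?enorm_ge0 ?mulr_ge0 ?normc_ge0 ?enorm_ge0//.
rewrite exprMn !enorm_sqr mulr_sumr; apply/eqP/eq_bigr => i _.
by rewrite mxE ComplexField.Normc.normcM exprMn.
Qed.

Lemma enormN n (v : 'cV[C]_n) : enorm (- v) = enorm v.
Proof.
by rewrite /enorm; congr Num.sqrt; apply: eq_bigr => i _; rewrite mxE normcN.
Qed.

Lemma enormD n (u v : 'cV[C]_n) : enorm (u + v) <= enorm u + enorm v.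
Proof.
rewrite -(@ler_pXn2r _ 2)// ?nnegrE ?addr_ge0 ?enorm_ge0// sqrrD.
rewrite enorm_sqr; apply: (@le_trans _ _
  (\sum_i (normc (u i ord0) + normc (v i ord0)) ^+ 2)).
  apply: ler_sum => i _; rewrite mxE ler_pXn2r// ?nnegrE ?addr_ge0 ?normc_ge0//.
  exact: le_normcD.
under eq_bigr do rewrite sqrrD.
rewrite !big_split/= -!enorm_sqr lerD2r lerD2l -mulr2n lerMn2r/=.
rewrite -(@ler_pXn2r _ 2)// ?nnegrE ?mulr_ge0 ?enorm_ge0//; last first.
  by apply: sumr_ge0 => i _; rewrite mulr_ge0 ?normc_ge0.
by rewrite exprMn !enorm_sqr cauchy_schwarz_sum.
Qed.

Lemma enorm_sum n (I : finType) (v : I -> 'cV[C]_n) :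
  enorm (\sum_i v i) <= \sum_i enorm (v i).
Proof.
apply: (big_ind2 (fun u r => enorm u <= r)) => //; first by rewrite enorm0.
by move=> u r v' s ur vs; apply: (le_trans (enormD _ _)); exact: lerD.
Qed.

Lemma enorm_col_mx m n (u : 'cV[C]_m) (v : 'cV[C]_n) :
  enorm (col_mx u v) ^+ 2 = enorm u ^+ 2 + enorm v ^+ 2.
Proof.
rewrite !enorm_sqr big_split_ord/=; congr (_ + _); apply: eq_bigr => i _.
  by rewrite col_mxEu.
by rewrite col_mxEd.
Qed.

Lemma normc_le_enorm n (v : 'cV[C]_n) i : normc (v i ord0) <= enorm v.
Proof.
rewrite -(@ler_pXn2r _ 2)// ?nnegrE ?normc_ge0 ?enorm_ge0//.
by rewrite enorm_sqr (bigD1 i)//= lerDl sumr_ge0// => j _; rewrite sqr_ge0.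
Qed.

Lemma enorm_sqrE n (v : 'cV[C]_n) :
  (enorm v ^+ 2)%:C%C = (map_mx Num.conj v^T *m v) ord0 ord0.
Proof.
rewrite enorm_sqr rmorph_sum mxE; apply: eq_bigr => i _.
rewrite !mxE mulrC -sqr_normc.
by rewrite rmorphXn; congr (_ ^+ 2); case: (v i ord0).
Qed.

(** The Gram matrix of [A] determines the quadratic form [v |-> |A v|^2]. *)
Lemma enorm_mulmx_gram m1 m2 n (A : 'M[C]_(m1, n)) (B : 'M[C]_(m2, n))
    (v : 'cV[C]_n) :
  map_mx Num.conj A^T *m A = map_mx Num.conj B^T *m B ->
  enorm (A *m v) = enorm (B *m v).
Proof.
move=> AB; apply/eqP; rewrite -(@eqrXn2 _ 2)// ?enorm_ge0//; apply/eqP.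
apply: (@complexI R); rewrite !enorm_sqrE !trmx_mul !map_mxM !mulmxA.
by rewrite -[_ *m A]mulmxA AB mulmxA.
Qed.

End euclidean_norm.

Section operator_norm.
Context {R : realType}.
Local Notation C := (R[i]%C).
Local Notation normc := (@ComplexField.Normc.normc R).

(** Makes the supremum that defines [mxnorm] the supremum of a bounded set. *)
Lemma mulmx_bounded m n (A : 'M[C]_(m, n)) :
  exists K, 0 <= K /\ forall v : 'cV[C]_n, enorm (A *m v) <= K * enorm v.
Proof.
exists (\sum_j enorm (col j A)); split.
  by rewrite sumr_ge0// => j _; exact: enorm_ge0.
move=> v; have -> : A *m v = \sum_j v j ord0 *: col j A.
  apply/matrixP => i k; rewrite ord1 mxE summxE; apply: eq_bigr => j _.
  by rewrite !mxE mulrC.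
apply: (le_trans (enorm_sum _)); rewrite mulr_suml; apply: ler_sum => j _.
by rewrite enormZ mulrC ler_wpM2l ?enorm_ge0 ?normc_le_enorm.
Qed.

Lemma enorm_mulmx_le m n (A : 'M[C]_(m, n)) (v : 'cV[C]_n) :
  enorm (A *m v) <= mxnorm A * enorm v.
Proof.
have [K [K0 AK]] := mulmx_bounded A.
have [->|v0] := eqVneq v 0; first by rewrite mulmx0 !enorm0 mulr0.
have nv0 : 0 < enorm v by rewrite enorm_gt0.
rewrite -ler_pdivrMr//; apply: ub_le_sup.
  exists K => _ [w w1 <-]; apply: (le_trans (AK w)).
  by rewrite ler_piMr.
exists ((enorm v)^-1%:C%C *: v) => /=.
  by rewrite enormZ normc_real ?invr_ge0 ?enorm_ge0// mulVf// gt_eqF.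
by rewrite -scalemxAr enormZ normc_real ?invr_ge0 ?enorm_ge0// mulrC.
Qed.

Lemma mxnorm_le m n (A : 'M[C]_(m, n)) c : 0 <= c ->
  (forall v, enorm (A *m v) <= c * enorm v) -> mxnorm A <= c.
Proof.
move=> c0 Ac; apply: ge_sup.
  by exists (enorm (A *m 0)); exists 0 => //=; rewrite enorm0.
by move=> _ [w /= w1 <-]; rewrite (le_trans (Ac w))// ler_piMr.
Qed.

Lemma mxnorm_ge0 m n (A : 'M[C]_(m, n)) : 0 <= mxnorm A.
Proof.
have [K [K0 AK]] := mulmx_bounded A.
apply: (le_trans (enorm_ge0 (A *m 0))); apply: ub_le_sup.
  exists K => _ [w w1 <-]; apply: (le_trans (AK w)).
  by rewrite ler_piMr.
by exists 0 => //=; rewrite enorm0.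
Qed.

Lemma mxnormP m n (A : 'M[C]_(m, n)) c : 0 <= c ->
  mxnorm A <= c <-> forall v, enorm (A *m v) <= c * enorm v.
Proof.
move=> c0; split=> [Ac v|]; last exact: mxnorm_le.
by rewrite (le_trans (enorm_mulmx_le _ _))// ler_wpM2r// enorm_ge0.
Qed.

Lemma mxnormZ m n (A : 'M[C]_(m, n)) (a : R) :
  0 <= a -> mxnorm (a%:C%C *: A) <= a * mxnorm A.
Proof.
move=> a0; apply: mxnorm_le; first by rewrite mulr_ge0// mxnorm_ge0.
move=> v; rewrite -scalemxAl enormZ normc_real//.
by rewrite -mulrA ler_wpM2l// enorm_mulmx_le.
Qed.

(** Cauchy--Schwarz in the pair of norms of the two components, applied to the
    first row of the block matrix. *)
Lemma mxnorm_block_triangular m n (A : 'M[C]_m) (B : 'M[C]_(m, n)) (D : 'M[C]_n) :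
  mxnorm (block_mx A B 0 D) ^+ 2 <=
  mxnorm A ^+ 2 + mxnorm B ^+ 2 + mxnorm D ^+ 2.
Proof.
set s := (X in _ <= X); have s0 : 0 <= s by rewrite !addr_ge0 ?sqr_ge0.
rewrite -(sqr_sqrtr s0) ler_pXn2r// ?nnegrE ?mxnorm_ge0 ?sqrtr_ge0//.
apply: mxnorm_le; first exact: sqrtr_ge0.
move=> v; rewrite -(vsubmxK v) mul_block_col mul0mx add0r.
set u := usubmx v; set w := dsubmx v.
rewrite -(@ler_pXn2r _ 2)// ?nnegrE ?mulr_ge0 ?enorm_ge0 ?sqrtr_ge0//.
rewrite exprMn (sqr_sqrtr s0) !enorm_col_mx.
have h1 : enorm (A *m u + B *m w) ^+ 2 <=
    (mxnorm A * enorm u + mxnorm B * enorm w) ^+ 2.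
  rewrite ler_pXn2r// ?nnegrE ?addr_ge0 ?mulr_ge0 ?enorm_ge0 ?mxnorm_ge0//.
  by rewrite (le_trans (enormD _ _))// lerD// enorm_mulmx_le.
have h2 : enorm (D *m w) ^+ 2 <= mxnorm D ^+ 2 * enorm w ^+ 2.
  rewrite -exprMn ler_pXn2r// ?nnegrE ?mulr_ge0 ?enorm_ge0 ?mxnorm_ge0//.
  exact: enorm_mulmx_le.
have h3 := sqr_ge0 (mxnorm A * enorm w - mxnorm B * enorm u).
have h4 := sqr_ge0 (mxnorm D * enorm u).
rewrite /s; move: h1 h2 h3 h4.
move: (mxnorm A) (mxnorm B) (mxnorm D) (enorm u) (enorm w) => a b e x y.
move: (enorm (A *m u + B *m w)) (enorm (D *m w)) => p q.
lra.
Qed.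

End operator_norm.

(** * Functional calculus of Hermitian matrices *)

Section unitary_diagonalization.
Context {C : numClosedFieldType} {n : nat}.
Implicit Types (P Q : 'M[C]_n) (D E : 'rV[C]_n).
Local Notation "M ^*t" := (map_mx Num.conj M^T) (at level 30).

Definition conjdiag P D : 'M[C]_n := invmx P *m diag_mx D *m P.

Lemma conjdiagM P D E : P \in unitmx ->
  conjdiag P D *m conjdiag P E = conjdiag P (\row_j (D ord0 j * E ord0 j)).
Proof.
move=> uP; rewrite /conjdiag !mulmxA mulmxK//.
by rewrite -[X in X *m _]mulmxA mulmx_diag.
Qed.

Lemma conjdiagD P D E : conjdiag P D + conjdiag P E = conjdiag P (D + E).
Proof. by rewrite /conjdiag -mulmxDl -mulmxDr -raddfD. Qed.

Lemma conjdiag_cst P c : P \in unitmx -> conjdiag P (const_mx c) = c%:M.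
Proof. by move=> uP; rewrite /conjdiag diag_const_mx scalar_mxC mulmxKV. Qed.

Lemma conjdiag_entry P D i j :
  conjdiag P D i j = \sum_k invmx P i k * D ord0 k * P k j.
Proof.
rewrite /conjdiag mxE; apply: eq_bigr => k _; congr (_ * _).
rewrite mxE (bigD1 k)//= big1 ?addr0 => [|l lk]; first by rewrite !mxE eqxx.
by rewrite !mxE (negbTE lk) mulr0.
Qed.

(** An entry of the transition matrix between two diagonalisations of the same
    matrix vanishes unless it links equal eigenvalues, so the transition matrix
    also intertwines the images of the eigenvalues under any map. *)
Lemma conjdiag_map (f : C -> C) P Q D E : P \in unitmx -> Q \in unitmx ->
  conjdiag P D = conjdiag Q E ->
  conjdiag P (map_mx f D) = conjdiag Q (map_mx f E).
Proof.
move=> uP uQ DE; pose M := P *m invmx Q.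
have DM : diag_mx D *m M = M *m diag_mx E.
  have := congr1 (fun X => P *m X *m invmx Q) DE.
  by rewrite /conjdiag /M !mulmxA mulmxV// mul1mx mulmxK// => ->.
have fM : diag_mx (map_mx f D) *m M = M *m diag_mx (map_mx f E).
  apply/matrixP => i j; have /matrixP/(_ i j) := DM.
  rewrite !mul_diag_mx !mul_mx_diag !mxE -!/(M i j).
  have [->|Mij0] := eqVneq (\sum_k P i k * invmx Q k j) 0.
    by rewrite !(mulr0, mul0r).
  by rewrite mulrC => /(mulfI Mij0) ->; rewrite mulrC.
have := congr1 (fun X => invmx P *m X *m Q) fM.
by rewrite /conjdiag /M !mulmxA mulmxKV// mulVmx// mul1mx.
Qed.

Lemma conjdiag_adjoint P D : P \is unitarymx ->
  (conjdiag P D)^*t = conjdiag P (map_mx Num.conj D).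
Proof.
move=> uP; rewrite /conjdiag invmx_unitary// !trmx_mul !map_mxM.
rewrite map_trmx trmxK -map_mx_comp (map_mx_id (@conjCK _)).
by rewrite tr_diag_mx map_diag_mx mulmxA.
Qed.

Lemma conjdiag_quadratic P D j (v := P^*t *m delta_mx j ord0 : 'cV[C]_n) :
  P \is unitarymx ->
  v != 0 /\ (v^*t *m conjdiag P D *m v) ord0 ord0 = D ord0 j.
Proof.
move=> uP; have Pv : P *m v = delta_mx j ord0.
  by rewrite /v mulmxA (unitarymxP uP) mul1mx.
split.
  apply/eqP => v0; move: Pv; rewrite v0 mulmx0 => /matrixP/(_ j ord0)/eqP.
  by rewrite !mxE !eqxx eq_sym oner_eq0.
rewrite /conjdiag invmx_unitary//.
have -> : v^*t *m (P^*t *m diag_mx D *m P) *m v =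
    (P *m v)^*t *m diag_mx D *m (P *m v).
  by rewrite [(P *m v)^T]trmx_mul map_mxM !mulmxA.
rewrite Pv mul_mx_diag mxE (bigD1 j)//= big1 ?addr0; last first.
  by move=> k kj; rewrite !mxE (negbTE kj) /= mulr0.
by rewrite !mxE !eqxx /= rmorph1 mul1r mulr1.
Qed.

Lemma hermsymmxP (A : 'M[C]_n) : A \is hermsymmx <-> A^*t = A.
Proof.
split=> [/is_hermitianmxP|h].
  by rewrite expr0 scale1r => <-.
by apply/is_hermitianmxP; rewrite expr0 scale1r h.
Qed.

Lemma hermitian_conjdiag (A : 'M[C]_n) : A \is hermsymmx ->
  conjdiag (spectralmx A) (spectral_diag A) = A.
Proof. by move=> hA; apply/esym/orthomx_spectralP; exact: hermitian_normalmx. Qed.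

Lemma conjdiag_spectral P D (A := conjdiag P D) : P \is unitarymx ->
  conjdiag (spectralmx A) (spectral_diag A) = A.
Proof.
by move=> uP; apply/esym/orthomx_spectralP/orthomx_spectral_subproof; exists (P, D).
Qed.

Lemma adjoint_involutive m1 m2 (A : 'M[C]_(m1, m2)) : (A^*t)^*t = A.
Proof. by rewrite map_trmx trmxK -map_mx_comp (map_mx_id (@conjCK _)). Qed.

Lemma gram_adjoint m1 (A : 'M[C]_(m1, n)) : (A^*t *m A)^*t = A^*t *m A.
Proof. by rewrite trmx_mul map_mxM adjoint_involutive. Qed.

End unitary_diagonalization.

Section functional_calculus.
Context {R : realType}.
Local Notation C := (R[i]%C).
Local Notation "M ^*t" := (map_mx Num.conj M^T) (at level 30).

Lemma conj_real_complex (a : R) : Num.conj (a%:C%C : C) = a%:C%C.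
Proof. by rewrite -[LHS]/(conjc _) conjc_real. Qed.

Definition eigen_re n (A : 'M[C]_n) (j : 'I_n) : R :=
  complex.Re (spectral_diag A ord0 j).

(** [mxpowR A s] is the case [g = powR ^~ s]; a general [g] is needed to reach
    powers as limits of polynomials. *)
Definition fcalc n (g : R -> R) (A : 'M[C]_n) : 'M[C]_n :=
  conjdiag (spectralmx A)
    (map_mx (fun z => (g (complex.Re z))%:C%C) (spectral_diag A)).

Lemma mxpowRE n (A : 'M[C]_n) s : mxpowR A s = fcalc (fun t => t `^ s) A.
Proof. by []. Qed.

Lemma eq_fcalc n (g h : R -> R) (A : 'M[C]_n) :
  (forall j, g (eigen_re A j) = h (eigen_re A j)) -> fcalc g A = fcalc h A.
Proof.
move=> gh; apply: (congr1 (conjdiag _)).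
by apply/matrixP => i j; rewrite !mxE (ord1 i); apply: congr1; exact: gh.
Qed.

Lemma fcalcM n (g h : R -> R) (A : 'M[C]_n) :
  fcalc g A *m fcalc h A = fcalc (fun t => g t * h t) A.
Proof.
rewrite /fcalc (conjdiagM _ _ (spectral_unit A)); apply: (congr1 (conjdiag _)).
apply/matrixP => i j; rewrite !mxE (ord1 i).
by symmetry; exact: (rmorphM (real_complex R)).
Qed.

Lemma fcalcD n (g h : R -> R) (A : 'M[C]_n) :
  fcalc g A + fcalc h A = fcalc (fun t => g t + h t) A.
Proof.
rewrite /fcalc conjdiagD; apply: (congr1 (conjdiag _)).
by apply/matrixP => i j; rewrite !mxE; symmetry; exact: (rmorphD (real_complex R)).
Qed.

Lemma fcalc_cst n (c : R) (A : 'M[C]_n) : fcalc (fun=> c) A = (c%:C%C)%:M.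
Proof.
rewrite -(conjdiag_cst (c%:C%C) (spectral_unit A)); apply: (congr1 (conjdiag _)).
by apply/matrixP => i j; rewrite !mxE.
Qed.

Lemma fcalc_id n (A : 'M[C]_n) : A \is hermsymmx -> fcalc id A = A.
Proof.
move=> hA; rewrite -[RHS](hermitian_conjdiag hA); apply: (congr1 (conjdiag _)).
apply/matrixP => i j; rewrite !mxE (ord1 i); apply: RRe_real.
by have /mxOverP := hermitian_spectral_diag_real hA.
Qed.

Lemma fcalc_entry n (g : R -> R) (A : 'M[C]_n) i j :
  fcalc g A i j = \sum_k invmx (spectralmx A) i k *
    (g (eigen_re A k))%:C%C * spectralmx A k j.
Proof. by rewrite /fcalc conjdiag_entry; apply: eq_bigr => k _; rewrite mxE. Qed.

Lemma fcalc_comp n (g h : R -> R) (A : 'M[C]_n) :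
  fcalc g (fcalc h A) = fcalc (g \o h) A.
Proof.
rewrite {1}/fcalc (conjdiag_map _ (spectral_unit _) (spectral_unit A)
  (conjdiag_spectral _ (spectral_unitarymx A))).
apply: (congr1 (conjdiag _)); by apply/matrixP => i j; rewrite !mxE.
Qed.

Lemma fcalc_adjoint n (g : R -> R) (A : 'M[C]_n) : (fcalc g A)^*t = fcalc g A.
Proof.
rewrite /fcalc (conjdiag_adjoint _ (spectral_unitarymx A)).
apply: (congr1 (conjdiag _)); apply/matrixP => i j.
by rewrite !mxE; exact: conj_real_complex.
Qed.

(** An eigenvalue is the value of the quadratic form at a unit eigenvector. *)
Lemma posdef_eigen_gt0 n (A : 'M[C]_n) j : posdefmx A -> 0 < eigen_re A j.
Proof.
move=> [hA pA].
have [v0] := conjdiag_quadratic (spectral_diag A) j (spectral_unitarymx A).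
rewrite (hermitian_conjdiag hA) => vAv.
have := pA _ v0; rewrite vAv /eigen_re.
by case: (spectral_diag A ord0 j) => a b; rewrite ltcE => /andP[].
Qed.

Lemma gram_form_gt0 m n (A : 'M[C]_(m, n)) (v : 'cV[C]_n) : A *m v != 0 ->
  0 < (v^*t *m (A^*t *m A) *m v) ord0 ord0.
Proof.
move=> Av0; have -> : v^*t *m (A^*t *m A) *m v = (A *m v)^*t *m (A *m v).
  by rewrite trmx_mul map_mxM !mulmxA.
by rewrite -enorm_sqrE ltcR exprn_gt0// enorm_gt0.
Qed.

Lemma posdef_gram n (A A' : 'M[C]_n) : A' *m A = 1%:M -> posdefmx (A^*t *m A).
Proof.
move=> AA'; split; first by apply/hermsymmxP; exact: gram_adjoint.
move=> v v0; apply: gram_form_gt0; apply: contra v0 => /eqP Av0.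
by rewrite -(mul1mx v) -AA' -mulmxA Av0 mulmx0.
Qed.

Lemma posdef_fcalc n (g : R -> R) (A : 'M[C]_n) :
  (forall j, 0 < g (eigen_re A j)) -> posdefmx (fcalc g A).
Proof.
move=> g0; pose r := fcalc (Num.sqrt \o g) A.
have -> : fcalc g A = r^*t *m r.
  rewrite fcalc_adjoint fcalcM; apply: eq_fcalc => j /=.
  by rewrite -expr2 sqr_sqrtr// ltW.
apply: (@posdef_gram _ _ (fcalc (fun t => (Num.sqrt (g t))^-1) A)).
rewrite fcalcM (@eq_fcalc _ _ (fun=> 1)) ?fcalc_cst// => j /=.
by rewrite mulVf// gt_eqF// sqrtr_gt0.
Qed.

Section powers.
Context n (A : 'M[C]_n).
Hypothesis pA : posdefmx A.

Let eig0 j : 0 < eigen_re A j. Proof. exact: posdef_eigen_gt0. Qed.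

Lemma mxpowR_posdef s : posdefmx (mxpowR A s).
Proof. by apply: (@posdef_fcalc _ (fun t => t `^ s)) => j; rewrite powR_gt0. Qed.

Lemma mxpowRD s t : mxpowR A s *m mxpowR A t = mxpowR A (s + t).
Proof.
rewrite !mxpowRE fcalcM.
by apply: eq_fcalc => j /=; rewrite powRD// (gt_eqF (eig0 j)) implybT.
Qed.

Lemma mxpowR0 : mxpowR A 0 = 1%:M.
Proof.
rewrite mxpowRE (@eq_fcalc _ _ (fun=> 1)).
  by rewrite fcalc_cst.
by move=> j; rewrite powRr0.
Qed.

Lemma mxpowR1 : mxpowR A 1 = A.
Proof.
rewrite mxpowRE -[RHS](fcalc_id pA.1).
by apply: eq_fcalc => j /=; rewrite powRr1// ltW.
Qed.

Lemma mxpowRM s t : mxpowR (mxpowR A s) t = mxpowR A (s * t).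
Proof.
rewrite !mxpowRE fcalc_comp.
by apply: eq_fcalc => j /=; rewrite powRrM.
Qed.

Lemma mxpowRK s : mxpowR A s *m mxpowR A (- s) = 1%:M.
Proof. by rewrite mxpowRD subrr mxpowR0. Qed.

Lemma mxpowRNK s : mxpowR A (- s) *m mxpowR A s = 1%:M.
Proof. by rewrite mxpowRD addNr mxpowR0. Qed.

Lemma mxpowR_adjoint s : (mxpowR A s)^*t = mxpowR A s.
Proof. by rewrite mxpowRE; exact: fcalc_adjoint. Qed.

End powers.

End functional_calculus.

(** * Measurability of powers and norms of matrices *)

Section complex_parts.
Context {R : realType}.
Local Notation C := (R[i]%C).
Implicit Types z w : C.

Lemma Re_add z w : complex.Re (z + w) = complex.Re z + complex.Re w.
Proof. by case: z w => [a b] [c d]. Qed.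

Lemma Im_add z w : complex.Im (z + w) = complex.Im z + complex.Im w.
Proof. by case: z w => [a b] [c d]. Qed.

Lemma Re_mul z w :
  complex.Re (z * w) = complex.Re z * complex.Re w - complex.Im z * complex.Im w.
Proof. by case: z w => [a b] [c d]. Qed.

Lemma Im_mul z w :
  complex.Im (z * w) = complex.Re z * complex.Im w + complex.Im z * complex.Re w.
Proof. by case: z w => [a b] [c d]. Qed.

Lemma Re_sum (I : finType) (F : I -> C) :
  complex.Re (\sum_i F i) = \sum_i complex.Re (F i).
Proof. by apply: (big_morph _ Re_add). Qed.

Lemma Im_sum (I : finType) (F : I -> C) :
  complex.Im (\sum_i F i) = \sum_i complex.Im (F i).
Proof. by apply: (big_morph _ Im_add). Qed.

Lemma Re_conj z : complex.Re (Num.conj z) = complex.Re z.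
Proof. by rewrite -[Num.conj z]/(conjc _); case: z. Qed.

Lemma Im_conj z : complex.Im (Num.conj z) = - complex.Im z.
Proof. by rewrite -[Num.conj z]/(conjc _); case: z. Qed.

Lemma Re_opp z : complex.Re (- z) = - complex.Re z.
Proof. by case: z. Qed.

Lemma Im_opp z : complex.Im (- z) = - complex.Im z.
Proof. by case: z. Qed.

End complex_parts.

Section measurable_matrices.
Context {R : realType} {dT : measure_display} {T : measurableType dT}.
Local Notation C := (R[i]%C).
Local Notation "M ^*t" := (map_mx Num.conj M^T) (at level 30).

Definition mxmeas k n (A : T -> 'M[C]_(k, n)) : Prop :=
  forall i j, measurable_fun setT (fun x => complex.Re (A x i j)) /\
              measurable_fun setT (fun x => complex.Im (A x i j)).

Lemma mxmeas_cst k n (A : 'M[C]_(k, n)) : mxmeas (fun=> A).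
Proof. by move=> i j; split; exact: measurable_cst. Qed.

Lemma mxmeasD k n (A B : T -> 'M[C]_(k, n)) :
  mxmeas A -> mxmeas B -> mxmeas (fun x => A x + B x).
Proof.
move=> mA mB i j; have [rA iA] := mA i j; have [rB iB] := mB i j; split.
- by under eq_fun do rewrite mxE Re_add; exact: measurable_funD.
- by under eq_fun do rewrite mxE Im_add; exact: measurable_funD.
Qed.

Lemma mxmeasN k n (A : T -> 'M[C]_(k, n)) : mxmeas A -> mxmeas (fun x => - A x).
Proof.
move=> mA i j; have [rA iA] := mA i j; split.
- by under eq_fun do rewrite mxE Re_opp; exact: measurable_funN.
- by under eq_fun do rewrite mxE Im_opp; exact: measurable_funN.
Qed.

Lemma mxmeasM k m n (A : T -> 'M[C]_(k, m)) (B : T -> 'M[C]_(m, n)) :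
  mxmeas A -> mxmeas B -> mxmeas (fun x => A x *m B x).
Proof.
move=> mA mB i j; split.
- under eq_fun do rewrite mxE Re_sum; apply: measurable_sum => l.
  have [rA iA] := mA i l; have [rB iB] := mB l j.
  under eq_fun do rewrite Re_mul.
  by apply: measurable_funB; exact: measurable_funM.
- under eq_fun do rewrite mxE Im_sum; apply: measurable_sum => l.
  have [rA iA] := mA i l; have [rB iB] := mB l j.
  under eq_fun do rewrite Im_mul.
  by apply: measurable_funD; exact: measurable_funM.
Qed.

Lemma mxmeas_adjoint k n (A : T -> 'M[C]_(k, n)) :
  mxmeas A -> mxmeas (fun x => (A x)^*t).
Proof.
move=> mA i j; have [rA iA] := mA j i; split.
- by under eq_fun do rewrite !mxE Re_conj.
- by under eq_fun do rewrite !mxE Im_conj; exact: measurable_funN.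
Qed.

Lemma mxmeas_col_mx k l n (A : T -> 'M[C]_(k, n)) (B : T -> 'M[C]_(l, n)) :
  mxmeas A -> mxmeas B -> mxmeas (fun x => col_mx (A x) (B x)).
Proof.
move=> mA mB i j; case: (split_ordP i) => l' ->.
- by under eq_fun do rewrite col_mxEu;
    under [X in _ /\ measurable_fun _ X]eq_fun do rewrite col_mxEu; exact: mA.
- by under eq_fun do rewrite col_mxEd;
    under [X in _ /\ measurable_fun _ X]eq_fun do rewrite col_mxEd; exact: mB.
Qed.

Lemma mxmeas_usubmx k l n (A : T -> 'M[C]_(k + l, n)) :
  mxmeas A -> mxmeas (fun x => usubmx (A x)).
Proof.
move=> mA i j; have [rA iA] := mA (lshift l i) j.
by split; [under eq_fun do rewrite mxE|under eq_fun do rewrite mxE].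
Qed.

Lemma mxmeas_dsubmx k l n (A : T -> 'M[C]_(k + l, n)) :
  mxmeas A -> mxmeas (fun x => dsubmx (A x)).
Proof.
move=> mA i j; have [rA iA] := mA (rshift k i) j.
by split; [under eq_fun do rewrite mxE|under eq_fun do rewrite mxE].
Qed.

Lemma mxmeas_row_mx k m n (A : T -> 'M[C]_(k, m)) (B : T -> 'M[C]_(k, n)) :
  mxmeas A -> mxmeas B -> mxmeas (fun x => row_mx (A x) (B x)).
Proof.
move=> mA mB i j; case: (split_ordP j) => l' ->.
- by under eq_fun do rewrite row_mxEl;
    under [X in _ /\ measurable_fun _ X]eq_fun do rewrite row_mxEl; exact: mA.
- by under eq_fun do rewrite row_mxEr;
    under [X in _ /\ measurable_fun _ X]eq_fun do rewrite row_mxEr; exact: mB.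
Qed.

Lemma mxmeas_block k l m n (A : T -> 'M[C]_(k, m)) (B : T -> 'M[C]_(k, n))
    (D : T -> 'M[C]_(l, m)) (E : T -> 'M[C]_(l, n)) :
  mxmeas A -> mxmeas B -> mxmeas D -> mxmeas E ->
  mxmeas (fun x => block_mx (A x) (B x) (D x) (E x)).
Proof.
by move=> mA mB mD mE; apply: mxmeas_col_mx; exact: mxmeas_row_mx.
Qed.

Lemma measurable_enorm n (v : T -> 'cV[C]_n) : mxmeas v ->
  measurable_fun setT (fun x => enorm (v x)).
Proof.
move=> mv; apply: (@measurableT_comp _ _ _ _ _ _ (@Num.sqrt R)).
  by apply: continuous_measurable_fun; exact: sqrt_continuous.
apply: measurable_sum => i; have [rv iv] := mv i ord0.
under eq_fun do rewrite normc_sqr.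
by apply: measurable_funD; exact: measurable_funX.
Qed.

Definition rational_vector n (w : {ffun 'I_n -> rat * rat}) : 'cV[C]_n :=
  \col_i (Complex (ratr (w i).1) (ratr (w i).2)).

Lemma rational_vector_dense n (v : 'cV[C]_n) e : 0 < e ->
  exists w : {ffun 'I_n -> rat * rat}, enorm (v - rational_vector w) <= e.
Proof.
move=> e0; pose k : R := n.+1%:R.
have k0 : 0 < k by rewrite ltr0n.
pose z := e / k; have ek0 : 0 < z by rewrite divr_gt0.
have approx (r : R) : exists q : rat, `|r - ratr q| <= z / 2.
  have : r - z / 2 < r + z / 2.
    by rewrite ltrD2l (@lt_trans _ _ 0)// ?oppr_lt0 divr_gt0.
  move=> /rat_in_itvoo[q]; rewrite in_itv/= => /andP[q1 q2]; exists q.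
  by rewrite ler_distlC; apply/andP; split; apply: ltW.
have [a aP] := choice approx.
exists [ffun i => (a (complex.Re (v i ord0)), a (complex.Im (v i ord0)))].
set u := v - _; have uE : u = \sum_i u i ord0 *: delta_mx i ord0.
  by rewrite {1}[u]matrix_sum_delta; apply: eq_bigr => i _; rewrite big_ord1.
have nu i : ComplexField.Normc.normc (u i ord0) <= z.
  rewrite /u !mxE ffunE /=; case: (v i ord0) => x y /=.
  rewrite -(@ler_pXn2r _ 2)// ?nnegrE ?sqrtr_ge0 ?(ltW ek0)//.
  rewrite sqr_sqrtr ?addr_ge0 ?sqr_ge0//.
  have sq (s : R) (q : rat) : `|s - ratr q| <= z / 2 ->
      (s - ratr q) ^+ 2 <= (z / 2) ^+ 2.
    move=> h; rewrite -real_normK ?num_real//.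
    by rewrite ler_pXn2r// ?nnegrE// divr_ge0// ltW.
  have h1 := sq _ _ (aP x); have h2 := sq _ _ (aP y).
  have := sqr_ge0 z; move: h1 h2; rewrite expr_div_n; lra.
have nd i : enorm (delta_mx i ord0 : 'cV[C]_n) = 1.
  apply/eqP; rewrite -(@eqrXn2 _ 2)// ?enorm_ge0// expr1n enorm_sqr.
  rewrite (bigD1 i)//= big1 ?addr0.
    by rewrite mxE !eqxx ComplexField.Normc.normc1 expr1n.
  by move=> l li; rewrite mxE (negbTE li) ComplexField.Normc.normc0 expr0n.
rewrite uE; apply: (le_trans (enorm_sum _)).
apply: (@le_trans _ _ (\sum_(i < n) z)).
  by apply: ler_sum => i _; rewrite enormZ nd mulr1.
rewrite sumr_const card_ord -mulr_natr /z mulrAC ler_pdivrMr// ler_wpM2l ?(ltW e0)//.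
by rewrite /k ler_nat.
Qed.

(** Both sides are Lipschitz in the vector, so that testing on a dense set of
    vectors suffices; being countable, that set makes [mxnorm] measurable. *)
Lemma mxnorm_le_rational m n (A : 'M[C]_(m, n)) c : 0 <= c ->
  mxnorm A <= c <-> forall w : {ffun 'I_n -> rat * rat},
    enorm (A *m rational_vector w) <= c * enorm (rational_vector w).
Proof.
move=> c0; split=> [/(mxnormP _ c0) h w|h]; first exact: h.
apply: mxnorm_le => // v; have [K [K0 AK]] := mulmx_bounded A.
apply/ler_addgt0Pr => e e0.
have [|w vw] := @rational_vector_dense n v (e / (c + K + 1)).
  by rewrite divr_gt0// ltr_wpDl// addr_ge0.
set z := rational_vector w in vw.
have h1 : enorm (A *m v) <= enorm (A *m z) + enorm (A *m (v - z)).
  by rewrite (le_trans _ (enormD _ _))// -mulmxDr subrKC.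
have h2 : enorm z <= enorm v + enorm (v - z).
  by rewrite -(enormN (v - z)) (le_trans _ (enormD _ _))// subKr.
have h3 := AK (v - z); have h4 := h w.
have h5 : (c + K + 1) * enorm (v - z) <= e.
  by rewrite mulrC -ler_pdivlMr// ltr_wpDl// addr_ge0.
have := enorm_ge0 (v - z); have := enorm_ge0 v.
move: h1 h2 h3 h4 h5; rewrite -/z.
move: (enorm _) (enorm _) (enorm _) (enorm _) (enorm _) => *; nra.
Qed.

Lemma measurable_mxnorm m n (A : T -> 'M[C]_(m, n)) : mxmeas A ->
  measurable_fun setT (fun x => mxnorm (A x)).
Proof.
move=> mA _; apply: (measurability _ (RGenOInfty.measurableE R)) => //.
move=> _ [_ [c ->] <-]; rewrite setTI.
rewrite (_ : _ @^-1` _ = ~` [set x | mxnorm (A x) <= c]); last first.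
  apply/seteqP; split=> x /=; rewrite in_itv/= andbT ltNge => h; exact/negP.
apply: measurableC; have [c0|c0] := leP 0 c; last first.
  rewrite (_ : [set x | _] = set0)// -subset0 => x /= xc.
  by have := lt_le_trans (le_lt_trans xc c0) (mxnorm_ge0 (A x)); rewrite ltxx.
pose w k : {ffun 'I_n -> rat * rat} := odflt [ffun=> (0, 0)] (unpickle k).
rewrite (_ : [set x | _] = \bigcap_k [set x |
    enorm (A x *m rational_vector (w k)) <= c * enorm (rational_vector (w k))]).
  apply: bigcapT_measurable => k.
  have := measurable_enorm (mxmeasM mA (mxmeas_cst (rational_vector (w k)))).
  move=> /(_ measurableT `]-oo, c * enorm (rational_vector (w k))]%classic).
  rewrite setTI => /(_ (measurable_itv _)); congr measurable.
apply/seteqP; split => [x /= /(mxnorm_le_rational _ c0) h k _|x h]; first exact: h.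
apply/(mxnorm_le_rational _ c0) => u.
by have := h (pickle u) I; rewrite /w /= pickleK.
Qed.

End measurable_matrices.

Lemma cvg_finite_sum {R : realType} (I : finType) (f : I -> nat -> R) (l : I -> R) :
  (forall i, f i @ \oo --> l i) -> (fun k => \sum_i f i k) @ \oo --> \sum_i l i.
Proof. by move=> fl; apply: cvg_big => //; exact: add_continuous. Qed.

Section measurable_functional_calculus.
Context {R : realType} {dT : measure_display} {T : measurableType dT}.
Local Notation C := (R[i]%C).
Context (n : nat) (A : T -> 'M[C]_n).
Hypotheses (mA : mxmeas A) (pA : forall x, posdefmx (A x)).

(** A power of a matrix is not an algebraic expression in its entries.  The class
    of functions [g] below contains the constants and the identity and is closed
    under sums, products and pointwise limits, hence under composition with the
    exponential on the left; it contains the logarithm, and thus all powers. *)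
Definition measurable_calculus (g : R -> R) := mxmeas (fun x => fcalc g (A x)).

Lemma measurable_calculus_cst c : measurable_calculus (fun=> c).
Proof.
rewrite /measurable_calculus; under eq_fun do rewrite fcalc_cst.
exact: mxmeas_cst.
Qed.

Lemma measurable_calculus_id : measurable_calculus id.
Proof.
rewrite /measurable_calculus; under eq_fun do rewrite (fcalc_id (pA _).1).
exact: mA.
Qed.

Lemma measurable_calculusD g h : measurable_calculus g -> measurable_calculus h ->
  measurable_calculus (fun t => g t + h t).
Proof.
move=> mg mh; have := mxmeasD mg mh.
by congr mxmeas; apply/funext => x; rewrite fcalcD.
Qed.

Lemma measurable_calculusM g h : measurable_calculus g -> measurable_calculus h ->
  measurable_calculus (fun t => g t * h t).
Proof.
move=> mg mh; have := mxmeasM mg mh.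
by congr mxmeas; apply/funext => x; rewrite fcalcM.
Qed.

Lemma measurable_calculus_lim (g_ : (R -> R)^nat) g :
  (forall k, measurable_calculus (g_ k)) ->
  (forall t, 0 < t -> g_ ^~ t @ \oo --> g t) -> measurable_calculus g.
Proof.
move=> mg g_g i j; split.
- apply: (@measurable_fun_cvg _ _ _ setT
    (fun k x => complex.Re (fcalc (g_ k) (A x) i j))) => [k|x _].
    by have [] := mg k i j.
  under eq_fun do rewrite fcalc_entry Re_sum.
  rewrite fcalc_entry Re_sum; apply: cvg_finite_sum => l.
  under eq_fun do rewrite mulrAC Re_mul mulr0 subr0.
  rewrite mulrAC Re_mul mulr0 subr0; apply: cvgMl_tmp.
  exact/g_g/posdef_eigen_gt0.
- apply: (@measurable_fun_cvg _ _ _ setT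
    (fun k x => complex.Im (fcalc (g_ k) (A x) i j))) => [k|x _].
    by have [] := mg k i j.
  under eq_fun do rewrite fcalc_entry Im_sum.
  rewrite fcalc_entry Im_sum; apply: cvg_finite_sum => l.
  under eq_fun do rewrite mulrAC Im_mul mulr0 add0r.
  rewrite mulrAC Im_mul mulr0 add0r; apply: cvgMl_tmp.
  exact/g_g/posdef_eigen_gt0.
Qed.

Lemma measurable_calculus_expR g : measurable_calculus g ->
  measurable_calculus (expR \o g).
Proof.
move=> mg; apply: (@measurable_calculus_lim
  (fun k t => series (exp_coeff (g t)) k)) => [k|t _]; last first.
  by rewrite /expR /comp; exact: is_cvg_series_exp_coeff.
have mX m : measurable_calculus (fun t => g t ^+ m).
  elim: m => [|m IH]; first exact: measurable_calculus_cst.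
  by under eq_fun do rewrite exprS; exact: measurable_calculusM.
elim: k => [|k IH].
  under eq_fun do rewrite /series /= big_nil.
  exact: measurable_calculus_cst.
have -> : (fun t => series (exp_coeff (g t)) k.+1) =
    (fun t => series (exp_coeff (g t)) k + g t ^+ k * (k`!%:R)^-1).
  by apply/funext => t; rewrite seriesSr.
apply: (measurable_calculusD IH); apply: (measurable_calculusM (mX k)).
exact: measurable_calculus_cst.
Qed.

(** Newton iterates for the equation [expR y = t] in [y]; contrary to the power
    series of the logarithm they converge for all positive [t]. *)
Fixpoint newton_ln k (t : R) : R :=
  if k is k'.+1 then newton_ln k' t - 1 + t * expR (- newton_ln k' t) else t - 1.

(** By convexity of the exponential the iterates stay above the solution and
    decrease; by continuity their limit solves the equation. *)
Lemma newton_ln_cvg t : 0 < t -> newton_ln ^~ t @ \oo --> ln t.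
Proof.
move=> t0; set y := newton_ln ^~ t.
have step z : ln t <= z - 1 + t * expR (- z).
  rewrite -{2}(lnK t0) -expRD; have := expR_ge1Dx (ln t - z); lra.
have ge k : ln t <= y k.
  case: k => [|k]; last exact: step.
  by have := step 0; rewrite oppr0 expR0 mulr1 add0r /y /= addrC.
have dec : nonincreasing_seq y.
  apply/nonincreasing_seqP => k; rewrite /y /= -/(y k).
  suff : t * expR (- y k) <= 1 by lra.
  by rewrite -{1}(lnK t0) -expRD -expR0 ler_expR subr_le0.
have /cvg_ex[/= l yl] : cvgn y.
  by apply: nonincreasing_is_cvgn => //; exists (ln t) => _ [k _ <-].
have yl1 : [sequence y k.+1]_k @ \oo --> l by rewrite cvg_shiftS.
have yl2 : [sequence y k.+1]_k @ \oo --> l - 1 + t * expR (- l).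
  apply: cvgD; first by apply: cvgB => //; exact: cvg_cst.
  apply: cvgMl_tmp; apply: continuous_cvg; first exact: continuous_expR.
  exact: cvgN.
have le : l = l - 1 + t * expR (- l) by exact: cvg_unique _ yl1 yl2.
have lt1 : t * expR (- l) = 1 by lra.
suff <- : expR l = t by rewrite expRK.
by rewrite -[LHS]mul1r -lt1 -mulrA -expRD addNr expR0 mulr1.
Qed.

Lemma measurable_calculus_ln : measurable_calculus (@ln R).
Proof.
have m1 c : measurable_calculus (fun=> c) := measurable_calculus_cst c.
apply: (measurable_calculus_lim _ newton_ln_cvg); elim=> [|k IH].
  exact: (measurable_calculusD measurable_calculus_id (m1 (-1))).
have mN : measurable_calculus (fun t => - newton_ln k t).
  have -> : (fun t => - newton_ln k t) = (fun t => -1 * newton_ln k t).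
    by apply/funext => t; rewrite mulN1r.
  exact: (measurable_calculusM (m1 (-1)) IH).
have mE := measurable_calculusM measurable_calculus_id (measurable_calculus_expR mN).
exact: (measurable_calculusD (measurable_calculusD IH (m1 (-1))) mE).
Qed.

Lemma mxmeas_mxpowR_posdef s : mxmeas (fun x => mxpowR (A x) s).
Proof.
rewrite (_ : (fun x => _) = fun x => fcalc (expR \o (fun t => s * ln t)) (A x)).
  exact: (measurable_calculus_expR (measurable_calculusM
    (measurable_calculus_cst s) measurable_calculus_ln)).
apply/funext => x; rewrite mxpowRE; apply: eq_fcalc => j /=.
by rewrite /powR gt_eqF// posdef_eigen_gt0.
Qed.

End measurable_functional_calculus.

(** * Averages over cubes *)

Section power_inequalities.
Context {R : realType}.
Implicit Types (x y z q s : R).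

(** A number of the unit interval is at most its power with exponent [s]; apply
    this to the two fractions [x / (x + y)] and [y / (x + y)]. *)
Lemma powR_subadditive s x y : 0 < s -> s <= 1 -> 0 <= x -> 0 <= y ->
  (x + y) `^ s <= x `^ s + y `^ s.
Proof.
move=> s0 s1 x0 y0; have [xy0|xy0] := eqVneq (x + y) 0.
  by rewrite xy0 powR0 ?gt_eqF// addr_ge0// powR_ge0.
have t0 : 0 < x + y by rewrite lt_neqAle eq_sym xy0 addr_ge0.
have frac u : 0 <= u -> u <= x + y -> u / (x + y) <= (u / (x + y)) `^ s.
  move=> u0 ut; have [->|un0] := eqVneq u 0.
    by rewrite mul0r powR0 ?gt_eqF.
  apply: ger1_powR => //; rewrite ler_pdivrMr// mul1r ut divr_gt0//.
  by rewrite lt_neqAle eq_sym un0.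
have split u : 0 <= u -> u `^ s = (u / (x + y)) `^ s * (x + y) `^ s.
  by move=> u0; rewrite -powRM ?divr_ge0 ?(ltW t0)// divfK.
rewrite (split x x0) (split y y0) -mulrDl ler_peMl ?powR_ge0//.
have := lerD (frac x x0 _) (frac y y0 _).
rewrite -mulrDl divff// => h; apply: h; first by rewrite lerDl.
by rewrite lerDr.
Qed.

(** Young's inequality for [x] and [1]. *)
Lemma powR_bernoulli q x : 1 <= q -> 0 <= x -> 1 + q * (x - 1) <= x `^ q.
Proof.
move=> q1 x0; have [->|qn1] := eqVneq q 1; first by rewrite powRr1//; lra.
have {qn1}q1 : 1 < q by rewrite lt_neqAle eq_sym qn1.
have q0 : 0 < q by lra.
have qm : 0 < q - 1 by lra.
pose r := q / (q - 1); have r0 : 0 < r by rewrite divr_gt0.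
have qr : q^-1 + r^-1 = 1 by rewrite /r; field; rewrite !gt_eqF.
have := conjugate_powR x0 ler01 q0 r0 qr; rewrite mulr1 powR1 => h.
have : q * x <= q * (x `^ q / q + 1 / r) by rewrite ler_pM2l.
rewrite mulrDr mulrCA divff ?gt_eqF// mulr1.
have -> : q * (1 / r) = q - 1 by rewrite /r; field; rewrite !gt_eqF.
lra.
Qed.

(** Summing Bernoulli's inequality at the three numbers divided by their mean. *)
Lemma powR_sum3_le q x y z : 1 <= q -> 0 <= x -> 0 <= y -> 0 <= z ->
  (x + y + z) `^ q <= 3 `^ (q - 1) * (x `^ q + y `^ q + z `^ q).
Proof.
move=> q1 x0 y0 z0; have q0 : 0 < q by lra.
have [s0|s0] := eqVneq (x + y + z) 0.
  by rewrite s0 powR0 ?gt_eqF// mulr_ge0 ?addr_ge0 ?powR_ge0.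
have {}s0 : 0 < x + y + z by rewrite lt_neqAle eq_sym s0 !addr_ge0.
have [m sE m0] : exists2 m, x + y + z = 3 * m & 0 < m.
  by exists ((x + y + z) / 3); [rewrite mulrC divfK|rewrite divr_gt0].
have b u : 0 <= u -> (1 + q * (u / m - 1)) * m `^ q <= u `^ q.
  move=> u0; have -> : u `^ q = (u / m) `^ q * m `^ q.
    by rewrite -powRM ?divr_ge0 ?(ltW m0)// divfK// gt_eqF.
  by rewrite ler_wpM2r ?powR_ge0// powR_bernoulli// divr_ge0// ltW.
have -> : (x + y + z) `^ q = 3 `^ (q - 1) * (3 * m `^ q).
  rewrite mulrA -{2}(@powRr1 _ 3)// -powRD; last by rewrite pnatr_eq0 implybT.
  by rewrite subrK -powRM ?(ltW m0)// sE.
rewrite ler_wpM2l ?powR_ge0//.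
have := lerD (lerD (b x x0) (b y y0)) (b z z0).
rewrite -!mulrDl; congr (_ * _ <= _).
have -> : z = 3 * m - x - y by lra.
by field; rewrite gt_eqF.
Qed.

Local Open Scope ereal_scope.

Lemma poweR_ler s (a b : \bar R) : (0 <= s)%R -> 0 <= a -> a <= b ->
  a `^ s <= b `^ s.
Proof.
move=> s0 a0 ab; apply: gt0_ler_poweR => //; rewrite in_itv/= ?a0 ?leey//.
by rewrite (le_trans a0 ab).
Qed.

Lemma poweR_subadditive s (a b : \bar R) : (0 < s)%R -> (s <= 1)%R ->
  0 <= a -> 0 <= b -> (a + b) `^ s <= a `^ s + b `^ s.
Proof.
move=> s0 s1; case: a b => [a| |//] [b| |//] a0 b0.
- rewrite -EFinD !poweR_EFin -EFinD lee_fin.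
  by apply: powR_subadditive; rewrite // -lee_fin.
- by rewrite !poweRyr ?gt_eqF// addey ?leey// gt_eqF// (lt_le_trans _ (poweR_ge0 _ _)).
- by rewrite !poweRyr ?gt_eqF// addye ?leey// gt_eqF// (lt_le_trans _ (poweR_ge0 _ _)).
- by rewrite !poweRyr ?gt_eqF// leey.
Qed.

Lemma poweR_sum3_le q (a b c : \bar R) : (1 <= q)%R -> 0 <= a -> 0 <= b -> 0 <= c ->
  (a + b + c) `^ q <= (3 `^ (q - 1))%:E * (a `^ q + b `^ q + c `^ q).
Proof.
move=> q1; have q0 : (0 < q)%R by lra.
have K0 : 0 < (3 `^ (q - 1))%:E :> \bar R by rewrite lte_fin powR_gt0.
have n (x : \bar R) : x `^ q != -oo by rewrite gt_eqF// (lt_le_trans _ (poweR_ge0 _ _)).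
case: a b c => [a| |//] [b| |//] [c| |//] a0 b0 c0.
  rewrite -!EFinD poweR_EFin -EFinM lee_fin.
  by apply: powR_sum3_le; rewrite // -lee_fin.
all: by rewrite !poweRyr ?gt_eqF// ?(addey, addye)//
  ?adde_eq_ninfty ?negb_or ?n// gt0_muley// leey.
Qed.

End power_inequalities.

Section lebesgue_completeness.
Context {R : realType} {d : nat}.
Local Notation C := (R[i]%C).
Local Notation X := (Rn R d).
Local Notation mu := (@leb R d).

Lemma leb_complete : measure_is_complete mu.
Proof. exact: measure_is_complete_caratheodory. Qed.

Lemma ae_eq_measurable (f g : X -> R) : {ae mu, forall x, f x = g x} ->
  measurable_fun setT f -> measurable_fun setT g.
Proof.
move=> fg /measurable_EFinP mf; apply/measurable_EFinP.
apply: (ae_measurable_fun leb_complete _ mf).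
by apply: filterS fg => x fgx _ /=; rewrite fgx.
Qed.

Lemma ae_eq_mxmeas k n (A B : X -> 'M[C]_(k, n)) :
  {ae mu, forall x, A x = B x} -> mxmeas A -> mxmeas B.
Proof.
move=> AB mA i j; have [rA iA] := mA i j; split.
- by apply: ae_eq_measurable rA; apply: filterS AB => x ->.
- by apply: ae_eq_measurable iA; apply: filterS AB => x ->.
Qed.

Lemma posdefmx1 n : posdefmx (1%:M : 'M[C]_n).
Proof.
have := @posdef_gram R n 1%:M 1%:M (mulmx1 _).
by rewrite trmx1 map_mx1 mulmx1.
Qed.

(** Where the weight is not positive definite its power has no meaning, but the
    identity matrix can be substituted there: the set is negligible and the
    measure is complete. *)
Lemma mxmeas_mxpowR n (W : X -> 'M[C]_n) s : matrix_weight W ->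
  mxmeas (fun x => mxpowR (W x) s).
Proof.
move=> [mW pW]; pose W' x := if `[< posdefmx (W x) >] then W x else 1%:M.
have pW' x : posdefmx (W' x) by rewrite /W'; case: asboolP => // _; exact: posdefmx1.
have WW' : {ae mu, forall x, W x = W' x}.
  by apply: filterS pW => x px; rewrite /W' asboolT.
have mW' : mxmeas W' by exact: ae_eq_mxmeas WW' mW.
apply: ae_eq_mxmeas (mxmeas_mxpowR_posdef mW' pW' s).
by apply: filterS WW' => x ->.
Qed.

End lebesgue_completeness.

Section cube_measure.
Context {R : realType} {d : nat}.
Local Notation X := (Rn R d).
Local Notation mu := (@leb R d).
Implicit Types Q : set X.

Lemma cube_measurable_leb Q : cubes Q ->
  measurable Q /\ exists2 v : R, 0 < v & mu Q = v%:E.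
Proof.
move=> [a [l [l0 ->]]]; pose b := [tuple tnth a i + l | i < d].
pose A : set (d.-tuple R) := [set x | forall i, tnth a i <= tnth x i <= tnth b i].
have QA : cube a l = A.
  by apply/seteqP; split => x h i; have := h i; rewrite tnth_mktuple.
have mA : measurable A.
  have -> : A = \bigcap_i ((fun x : d.-tuple R => tnth x i) @^-1`
      [set` `[tnth a i, tnth b i]]).
    apply/seteqP; split => [x h i _|x h i] /=; first by rewrite in_itv; exact: h.
    by have := h i I; rewrite /= in_itv.
  apply: fin_bigcap_measurable => // i _.
  by rewrite -[X in measurable X]setTI; exact: measurable_tnth.
split; first by rewrite QA; exact: caratheodory_measurable_mu_ext.
exists (\prod_(i < d) (tnth b i - tnth a i)).
  by apply: prodr_gt0 => i _; rewrite tnth_mktuple addrAC subrr add0r.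
rewrite -lebesgue_tuple_box => [|i]; last by rewrite tnth_mktuple lerDl ltW.
by rewrite QA; exact: measurable_mu_extE.
Qed.

Lemma unit_cube : cubes (cube (nseq_tuple d 0) 1 : set X).
Proof. by exists (nseq_tuple d 0), 1. Qed.

End cube_measure.

Lemma measurable_fun_inv {R : realType} {dT : measure_display} {T : measurableType dT}
    (w : T -> R) : measurable_fun setT w -> (forall x, 0 <= w x) ->
  measurable_fun setT (fun x => (w x)^-1).
Proof.
move=> mw w0; rewrite (_ : (fun x => _) = (fun x => w x `^ (-1))).
  exact: (measurableT_comp (measurable_powR (-1)) mw).
by apply/funext => x; rewrite powR_inv1.
Qed.

Section means.
Context {R : realType} {d : nat}.
Local Notation X := (Rn R d).
Local Notation mu := (@leb R d).
Context (Q : set X).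
Hypothesis cQ : cubes Q.
Local Open Scope ereal_scope.

Let mQ : measurable Q. Proof. by have [] := cube_measurable_leb cQ. Qed.

Let c : R := (fine (mu Q))^-1.

Let c_gt0 : (0 < c)%R.
Proof.
by rewrite /c; have [_ [v v0 ->]] := cube_measurable_leb cQ; rewrite invr_gt0.
Qed.

Let c_leb : c%:E * mu Q = 1.
Proof.
rewrite /c; have [_ [v v0 ->]] := cube_measurable_leb cQ.
by rewrite -EFinM mulVf// gt_eqF.
Qed.

Lemma mean_ge0 (f : X -> \bar R) : (forall x, 0 <= f x) -> 0 <= mean Q f.
Proof.
move=> f0; apply: mule_ge0; first by rewrite lee_fin ltW.
by apply: integral_ge0 => x _.
Qed.

Lemma mean_le (f g : X -> \bar R) :
  measurable_fun setT f -> measurable_fun setT g ->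
  (forall x, 0 <= f x) -> (forall x, 0 <= g x) ->
  {ae mu, forall x, f x <= g x} -> mean Q f <= mean Q g.
Proof.
move=> mf mg f0 g0 fg; rewrite lee_pmul2l ?lte_fin//.
apply: ae_ge0_le_integral => //; [exact: measurable_funTS|exact: measurable_funTS|].
by apply: filterS fg => x.
Qed.

Lemma meanD (f g : X -> \bar R) :
  measurable_fun setT f -> measurable_fun setT g ->
  (forall x, 0 <= f x) -> (forall x, 0 <= g x) ->
  mean Q (fun x => f x + g x) = mean Q f + mean Q g.
Proof.
move=> mf mg f0 g0; rewrite /mean ge0_integralD//; try exact: measurable_funTS.
by rewrite ge0_muleDr//; apply: integral_ge0 => x _.
Qed.

Lemma meanZl (k : \bar R) (f : X -> \bar R) : 0 <= k ->
  measurable_fun setT f -> (forall x, 0 <= f x) ->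
  mean Q (fun x => k * f x) = k * mean Q f.
Proof.
move=> k0 mf f0; rewrite /mean ge0_integralZl//; last exact: measurable_funTS.
by rewrite muleCA.
Qed.

Lemma mean1 : mean Q (fun=> 1) = 1.
Proof. by rewrite /mean integral_cst// mul1e. Qed.

(** Encodes an average over the cube as a norm of the whole space, so that the
    inequalities of Hölder and Minkowski apply to averages. *)
Definition mean_density (r : R) (f : X -> R) (x : X) : R :=
  (c `^ r^-1 * (\1_Q x * f x))%R.

Lemma measurable_mean_density (r : R) (f : X -> R) : measurable_fun setT f ->
  measurable_fun setT (mean_density r f).
Proof.
move=> mf; apply: (measurable_funM (measurable_cst _)).
exact: (measurable_funM (measurable_indic mQ) mf).
Qed.

Lemma Lnorm_mean_density (r : R) (f : X -> R) : (0 < r)%R -> measurable_fun setT f ->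
  (forall x, 0 <= f x)%R ->
  'N[mu]_r%:E[EFin \o mean_density r f] = mean Q (fun x => (f x `^ r)%:E) `^ r^-1.
Proof.
move=> r0 mf f0; rewrite unlock; congr (_ `^ _).
have mfr : measurable_fun setT (fun x => (f x `^ r)%:E).
  by apply/measurable_EFinP; exact: (measurableT_comp (measurable_powR r) mf).
transitivity (\int[mu]_x (c%:E * ((fun x => (f x `^ r)%:E) \_ Q) x)).
  apply: eq_integral => x _; rewrite /mean_density /=.
  have i0 : (0 <= \1_Q x * f x)%R by rewrite mulr_ge0.
  rewrite ger0_norm ?(mulr_ge0 (powR_ge0 _ _) i0)// powRM ?powR_ge0//.
  rewrite -powRrM mulVf ?gt_eqF// powRr1 ?(ltW c_gt0)// EFinM; congr (_ * _).
  rewrite patchE indicE; case: ifPn => xQ; first by rewrite mul1r.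
  by rewrite mul0r powR0// gt_eqF.
rewrite ge0_integralZl; first by rewrite -integral_mkcond.
- exact: measurableT.
- exact: ((measurable_restrictT _ mQ).1 (measurable_funTS mfr)).
- by move=> x _; rewrite patchE; case: ifPn => // _; rewrite lee_fin powR_ge0.
- by rewrite lee_fin ltW.
Qed.

Lemma mean_minkowski (r : R) (f g : X -> R) : (1 <= r)%R ->
  measurable_fun setT f -> measurable_fun setT g ->
  (forall x, 0 <= f x)%R -> (forall x, 0 <= g x)%R ->
  mean Q (fun x => ((f x + g x) `^ r)%:E) `^ r^-1 <=
  mean Q (fun x => (f x `^ r)%:E) `^ r^-1 + mean Q (fun x => (g x `^ r)%:E) `^ r^-1.
Proof.
move=> r1 mf mg f0 g0; have r0 : (0 < r)%R by lra.
rewrite -(Lnorm_mean_density r0 mf f0) -(Lnorm_mean_density r0 mg g0).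
rewrite -(Lnorm_mean_density r0 (measurable_funD mf mg)); last first.
  by move=> x; rewrite addr_ge0.
have := @minkowski_EFin _ _ _ mu _ _ r (measurable_mean_density r mf)
  (measurable_mean_density r mg) r1.
congr (_ <= _); congr (Lnorm _ _ _); apply/funext => x /=.
by congr EFin; rewrite /mean_density -mulrDr -mulrDr.
Qed.

Lemma mean_hoelder (p p' : R) (w : X -> R) : (0 < p)%R -> (0 < p')%R ->
  (p^-1 + p'^-1 = 1)%R -> measurable_fun setT w ->
  (forall x, 0 <= w x)%R -> {ae mu, forall x, (0 < w x)%R} ->
  1 <= mean Q (fun x => (w x `^ p)%:E) `^ p^-1 *
       mean Q (fun x => ((w x)^-1 `^ p')%:E) `^ p'^-1.
Proof.
move=> p0 p'0 pp' mw w0 wae.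
have mwV := measurable_fun_inv mw w0.
rewrite -(Lnorm_mean_density p0 mw w0) -(Lnorm_mean_density p'0 mwV); last first.
  by move=> x; rewrite invr_ge0.
apply: le_trans (hoelder mu (measurable_mean_density p mw)
  (measurable_mean_density p' mwV) p0 p'0 pp').
rewrite Lnorm1.
have mww : measurable_fun setT (fun x => (w x / w x)%:E).
  by apply/measurable_EFinP; exact: measurable_funM.
have ww0 x : (0 <= w x / w x)%R by rewrite divr_ge0.
have -> : \int[mu]_x
    `|(EFin \o (mean_density p w \* mean_density p' (fun x => (w x)^-1))%R) x| =
    mean Q (fun x => (w x / w x)%:E).
  transitivity (\int[mu]_x (c%:E * ((fun x => (w x / w x)%:E) \_ Q) x)).
    apply: eq_integral => x _; rewrite /mean_density /= patchE indicE.
    rewrite ger0_norm; last first.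
      by rewrite !mulr_ge0 ?powR_ge0 ?invr_ge0.
    rewrite mulrACA -powRD ?pp' ?powRr1 ?(ltW c_gt0) ?oner_eq0// EFinM.
    congr (_ * _); case: ifPn => xQ; first by rewrite !mul1r.
    by rewrite !mul0r.
  rewrite ge0_integralZl; first by rewrite -integral_mkcond.
  - exact: measurableT.
  - exact: ((measurable_restrictT _ mQ).1 (measurable_funTS mww)).
  - by move=> x _; rewrite patchE; case: ifPn => // _; rewrite lee_fin.
  - by rewrite lee_fin ltW.
rewrite -[leLHS]mean1; apply: mean_le.
- exact: measurable_cst.
- exact: mww.
- by [].
- by move=> x; rewrite lee_fin.
- by apply: filterS wae => x wx; rewrite divff// gt_eqF.
Qed.

End means.

(** * Mixed averages of kernels *)

Section mixed_means.
Context {R : realType} {d : nat}.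
Local Notation X := (Rn R d).
Local Notation mu := (@leb R d).
Context (p p' : R) (Q : set X).
Hypotheses (cQ : cubes Q) (p_gt1 : 1 < p) (conj_pp' : p^-1 + p'^-1 = 1).
Implicit Types (f g h n : X -> R) (k : X -> X -> R).

Lemma conjugate_gt1 : 1 < p'.
Proof.
have p0 : 0 < p := lt_trans ltr01 p_gt1.
have pV : 0 < p^-1 < 1 by rewrite invr_gt0 p0 invf_lt1.
have : 0 < p'^-1 < 1 by move: pV conj_pp' => /andP[]; lra.
by rewrite invr_gt0 => /andP[p'0]; rewrite invf_lt1.
Qed.

Let p_gt0 : 0 < p := lt_trans ltr01 p_gt1.
Let p'_gt0 : 0 < p' := lt_trans ltr01 conjugate_gt1.

Lemma div_conjugate : p / p' = p - 1.
Proof.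
have -> : p'^-1 = 1 - p^-1 by move: conj_pp'; lra.
by rewrite mulrBr mulr1 divff// gt_eqF.
Qed.

Let mul_conjugate : p * p' = p + p'.
Proof.
rewrite -[LHS]mulr1 -conj_pp'.
have := p_gt0; have := p'_gt0 => *; by field; rewrite !gt_eqF.
Qed.

Let conjugate_ge2 : p <= 2 -> 1 <= p' / 2.
Proof.
move=> p2; rewrite ler_pdivlMr// mul1r.
move: mul_conjugate p_gt1 p'_gt0; nra.
Qed.

Let conjugate_le2 : 2 <= p -> p' / 2 <= 1.
Proof.
move=> p2; rewrite ler_pdivrMr// mul1r.
move: mul_conjugate p'_gt0; nra.
Qed.

Local Open Scope ereal_scope.

Definition dual_mean (f : X -> R) : \bar R :=
  mean Q (fun y => (f y `^ p')%:E) `^ (p / p').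

Definition mixed_mean (k : X -> X -> R) : \bar R := mean Q (fun x => dual_mean (k x)).

Lemma dual_mean_ge0 f : 0 <= dual_mean f.
Proof. exact: poweR_ge0. Qed.

Let measurable_power (f : X -> R) (s : R) : measurable_fun setT f ->
  measurable_fun setT (fun x => (f x `^ s)%:E).
Proof.
move=> mf; apply/measurable_EFinP.
exact: (measurableT_comp (measurable_powR s) mf).
Qed.

Let power_ge0 (f : X -> R) (s : R) (x : X) : 0 <= (f x `^ s)%:E.
Proof. by rewrite lee_fin powR_ge0. Qed.

Let measurable_sqr (f : X -> R) : measurable_fun setT f ->
  measurable_fun setT (fun x => f x ^+ 2)%R.
Proof. exact: measurable_funX. Qed.

Lemma powR_half_sqr (s t : R) : (0 <= t)%R -> ((t ^+ 2) `^ (s / 2) = t `^ s)%R.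
Proof. by move=> t0; rewrite -powR_mulrn// -powRrM mulrC divfK. Qed.

(** Here [p' / 2 >= 1]: Minkowski's inequality with exponent [p' / 2] separates
    the three squares, and the remaining power [p / 2 <= 1] is subadditive. *)
Lemma dual_mean_pythagoras_le2 (f g h n : X -> R) : (p <= 2)%R ->
  measurable_fun setT f -> measurable_fun setT g -> measurable_fun setT h ->
  measurable_fun setT n ->
  (forall x, 0 <= f x)%R -> (forall x, 0 <= g x)%R -> (forall x, 0 <= h x)%R ->
  (forall x, 0 <= n x)%R ->
  {ae mu, forall x, (n x ^+ 2 <= f x ^+ 2 + g x ^+ 2 + h x ^+ 2)%R} ->
  dual_mean n <= dual_mean f + dual_mean g + dual_mean h.
Proof.
move=> p2 mf mg mh mn f0 g0 h0 n0 nfgh.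
pose r := (p' / 2)%R; have r1 : (1 <= r)%R := conjugate_ge2 p2.
have r0 : (0 < r)%R := lt_le_trans ltr01 r1.
have dualE (u : X -> R) : (forall x, 0 <= u x)%R -> dual_mean u =
    (mean Q (fun x => ((u x ^+ 2) `^ r)%:E) `^ r^-1) `^ (p / 2).
  move=> u0; rewrite -poweRrM /dual_mean; congr (mean _ _ `^ _).
    by apply/funext => x; rewrite powR_half_sqr.
  by rewrite /r; field; rewrite gt_eqF.
rewrite !dualE//.
have p20 : (0 < p / 2)%R by rewrite divr_gt0.
have p21 : (p / 2 <= 1)%R by rewrite ler_pdivrMr// mul1r.
have rV0 : (0 <= r^-1)%R by rewrite invr_ge0 ltW.
have mS := measurable_funD (measurable_funD (measurable_sqr mf) (measurable_sqr mg))
  (measurable_sqr mh).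
apply: (@le_trans _ _ ((mean Q (fun x => ((f x ^+ 2) `^ r)%:E) `^ r^-1 +
  mean Q (fun x => ((g x ^+ 2) `^ r)%:E) `^ r^-1 +
  mean Q (fun x => ((h x ^+ 2) `^ r)%:E) `^ r^-1) `^ (p / 2))); last first.
  apply: le_trans (poweR_subadditive p20 p21 _ _) _; rewrite ?adde_ge0 ?poweR_ge0//.
  by apply: leeD => //; apply: poweR_subadditive; rewrite ?poweR_ge0.
apply: poweR_ler; [exact: ltW|exact: poweR_ge0|].
apply: (@le_trans _ _ (mean Q (fun x =>
    ((f x ^+ 2 + g x ^+ 2 + h x ^+ 2) `^ r)%:E) `^ r^-1)).
  apply: (poweR_ler rV0).
    by apply: (mean_ge0 cQ) => x; exact: (power_ge0 (fun x => n x ^+ 2)%R).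
  apply: (mean_le cQ).
  - exact: (measurable_power _ (measurable_sqr mn)).
  - exact: (measurable_power _ mS).
  - by move=> x; exact: (power_ge0 (fun x => n x ^+ 2)%R).
  - by move=> x; exact: (power_ge0 (fun x => f x ^+ 2 + g x ^+ 2 + h x ^+ 2)%R).
  apply: filterS nfgh => x nx.
  by rewrite lee_fin ge0_ler_powR ?nnegrE ?(ltW r0) ?addr_ge0 ?sqr_ge0.
apply: (le_trans (mean_minkowski cQ r1 (measurable_funD (measurable_sqr mf)
  (measurable_sqr mg)) (measurable_sqr mh) _ _)).
- by move=> x; rewrite addr_ge0 ?sqr_ge0.
- by move=> x; rewrite sqr_ge0.
apply: leeD => //.
apply: (mean_minkowski cQ r1 (measurable_sqr mf) (measurable_sqr mg)).
- by move=> x; rewrite sqr_ge0.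
- by move=> x; rewrite sqr_ge0.
Qed.

(** Here [p' / 2 <= 1] is subadditive already under the average, and the remaining
    power [p / p' = p - 1 >= 1] is convex. *)
Lemma dual_mean_pythagoras_ge2 (f g h n : X -> R) : (2 <= p)%R ->
  measurable_fun setT f -> measurable_fun setT g -> measurable_fun setT h ->
  measurable_fun setT n ->
  (forall x, 0 <= f x)%R -> (forall x, 0 <= g x)%R -> (forall x, 0 <= h x)%R ->
  (forall x, 0 <= n x)%R ->
  {ae mu, forall x, (n x ^+ 2 <= f x ^+ 2 + g x ^+ 2 + h x ^+ 2)%R} ->
  dual_mean n <= (3 `^ (p - 2))%:E * (dual_mean f + dual_mean g + dual_mean h).
Proof.
move=> p2 mf mg mh mn f0 g0 h0 n0 nfgh.
pose r := (p' / 2)%R; have r0 : (0 < r)%R by rewrite divr_gt0.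
have r1 : (r <= 1)%R := conjugate_le2 p2.
have q1 : (1 <= p / p')%R by rewrite div_conjugate; lra.
rewrite (_ : p - 2 = p / p' - 1)%R; last by rewrite div_conjugate; lra.
have M0 (u : X -> R) : 0 <= mean Q (fun y => (u y `^ p')%:E).
  by apply: mean_ge0 => // x; exact: power_ge0.
apply: le_trans (poweR_sum3_le q1 (M0 f) (M0 g) (M0 h)).
apply: poweR_ler; [by rewrite ltW// divr_gt0|exact: M0|].
have mP (u : X -> R) (mu_ : measurable_fun setT u) := measurable_power p' mu_.
have P0 (u : X -> R) := power_ge0 u p'.
rewrite -(meanD cQ (mP _ mf) (mP _ mg) (P0 f) (P0 g)).
rewrite -(meanD cQ (emeasurable_funD (mP _ mf) (mP _ mg)) (mP _ mh)); last 2 first.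
- by move=> x; rewrite adde_ge0.
- exact: P0.
apply: (mean_le cQ (mP _ mn)).
- exact: (emeasurable_funD (emeasurable_funD (mP _ mf) (mP _ mg)) (mP _ mh)).
- exact: P0.
- by move=> x; rewrite !adde_ge0.
apply: filterS nfgh => x nx; rewrite -!EFinD lee_fin.
rewrite -!(powR_half_sqr p')//.
apply: (@le_trans _ _ ((f x ^+ 2 + g x ^+ 2 + h x ^+ 2) `^ r)%R).
  by rewrite ge0_ler_powR ?nnegrE ?(ltW r0) ?addr_ge0 ?sqr_ge0.
apply: le_trans (powR_subadditive r0 r1 _ _) _; rewrite ?addr_ge0 ?sqr_ge0//.
by rewrite lerD2r; apply: powR_subadditive; rewrite ?sqr_ge0.
Qed.

Definition joint_measurable (k : X -> X -> R) :=
  measurable_fun [set: X * X] (fun z => k z.1 z.2).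

Lemma joint_measurable_section k x : joint_measurable k -> measurable_fun setT (k x).
Proof.
move=> mk; exact: (measurableT_comp mk (pair1_measurable x)).
Qed.

(** The measurability part of Tonelli's theorem. *)
Lemma measurable_dual_mean k : joint_measurable k ->
  measurable_fun setT (fun x => dual_mean (k x)).
Proof.
move=> mk; apply: (measurableT_comp (measurable_poweR _)).
have [mQ _] := cube_measurable_leb cQ.
apply: measurable_funeM.
pose F (z : X * X) : \bar R := (k z.1 z.2 `^ p' * \1_Q z.2)%:E.
have -> : (fun x => \int[mu]_(y in Q) (k x y `^ p')%:E) = fubini_F mu F.
  apply/funext => x; rewrite /fubini_F [LHS]integral_mkcond.
  apply: eq_integral => y _; rewrite patchE /F /= indicE.
  case: ifPn => yQ; first by rewrite mulr1.
  by rewrite mulr0.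
apply: measurable_fun_fubini_tonelli_F.
  apply/measurable_EFinP; apply: measurable_funM.
    exact: (measurableT_comp (measurable_powR p') mk).
  exact: (measurableT_comp (measurable_indic mQ) measurable_snd).
by move=> z; rewrite lee_fin mulr_ge0 ?powR_ge0.
Qed.

Lemma mixed_mean_ge0 k : 0 <= mixed_mean k.
Proof. by apply: mean_ge0 => // x; exact: dual_mean_ge0. Qed.

Lemma dual_meanZ (t : R) f : (0 <= t)%R -> measurable_fun setT f ->
  (forall x, 0 <= f x)%R ->
  dual_mean (fun x => t * f x)%R = (t `^ p)%:E * dual_mean f.
Proof.
move=> t0 mf f0; rewrite /dual_mean.
have -> : (fun y => ((t * f y) `^ p')%:E) = (fun y => (t `^ p')%:E * (f y `^ p')%:E).
  by apply/funext => y; rewrite powRM.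
have tp0 : 0 <= (t `^ p')%:E by rewrite lee_fin powR_ge0.
rewrite (meanZl cQ tp0 (measurable_power p' mf) (power_ge0 f p')).
rewrite (poweRM _ tp0 (mean_ge0 cQ (power_ge0 f p'))) poweR_EFin -powRrM.
by rewrite mulrC divfK// gt_eqF.
Qed.

Lemma mixed_meanZ (t : R) k : (0 <= t)%R -> joint_measurable k ->
  (forall x y, 0 <= k x y)%R ->
  mixed_mean (fun x y => t * k x y)%R = (t `^ p)%:E * mixed_mean k.
Proof.
move=> t0 mk k0; rewrite /mixed_mean.
rewrite -(meanZl cQ _ (measurable_dual_mean mk)); last 2 first.
- by rewrite lee_fin powR_ge0.
- by move=> x; exact: dual_mean_ge0.
congr (mean Q _); apply/funext => x.
exact: (dual_meanZ t0 (joint_measurable_section x mk) (k0 x)).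
Qed.

(** For exponents up to 2 the three contributions simply add; beyond 2 the factor
    [3 `^ (p - 2)] comes from the convexity of the power [p - 1]. *)
Lemma mixed_mean_pythagoras (a b e k : X -> X -> R) (G : X -> Prop) :
  joint_measurable a -> joint_measurable b -> joint_measurable e ->
  joint_measurable k ->
  (forall x y, 0 <= a x y)%R -> (forall x y, 0 <= b x y)%R ->
  (forall x y, 0 <= e x y)%R -> (forall x y, 0 <= k x y)%R ->
  {ae mu, forall x, G x} ->
  (forall x y, G x -> G y ->
    (k x y ^+ 2 <= a x y ^+ 2 + b x y ^+ 2 + e x y ^+ 2)%R) ->
  mixed_mean k <= (Num.max 1 (3 `^ (p - 2)))%:E *
    (mixed_mean a + mixed_mean b + mixed_mean e).
Proof.
move=> ma mb me mk a0 b0 e0 k0 aeG kabe; set K := Num.max _ _.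
have K0 : (0 <= K)%R by rewrite le_max ler01.
have [dma dmb] := (measurable_dual_mean ma, measurable_dual_mean mb).
have [dme dmk] := (measurable_dual_mean me, measurable_dual_mean mk).
have dk0 (l : X -> X -> R) x : 0 <= dual_mean (l x) by exact: dual_mean_ge0.
have dab0 x : 0 <= dual_mean (a x) + dual_mean (b x) by rewrite adde_ge0.
have dabe0 x : 0 <= dual_mean (a x) + dual_mean (b x) + dual_mean (e x).
  by rewrite adde_ge0.
have dmab := emeasurable_funD dma dmb; have dmabe := emeasurable_funD dmab dme.
rewrite -(meanD cQ dma dmb (dk0 a) (dk0 b)) -(meanD cQ dmab dme dab0 (dk0 e)).
rewrite -(meanZl cQ _ dmabe dabe0) ?lee_fin//.
apply: (mean_le cQ dmk (measurable_funeM _ dmabe) (dk0 k)).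
  by move=> x; rewrite mule_ge0 ?lee_fin.
apply: (filterS _ aeG) => x Gx.
have aek : {ae mu, forall y,
    (k x y ^+ 2 <= a x y ^+ 2 + b x y ^+ 2 + e x y ^+ 2)%R}.
  by apply: (filterS _ aeG) => y; exact: kabe.
have S := fun l => @joint_measurable_section l x.
have [p2|/ltW p2] := leP p 2%R.
  apply: (le_trans (dual_mean_pythagoras_le2 p2 (S _ ma) (S _ mb) (S _ me) (S _ mk)
    (a0 x) (b0 x) (e0 x) (k0 x) aek)).
  by rewrite -[leLHS]mul1e lee_wpmul2r// lee_fin le_max lexx.
apply: (le_trans (dual_mean_pythagoras_ge2 p2 (S _ ma) (S _ mb) (S _ me) (S _ mk)
  (a0 x) (b0 x) (e0 x) (k0 x) aek)).
by rewrite lee_wpmul2r// lee_fin le_max lexx orbT.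
Qed.

(** The kernel [w x / w y] has mixed average at least 1, by Hölder's inequality
    for [w] and its inverse. *)
Lemma mixed_mean_ge1 (k : X -> X -> R) (w : X -> R) (G : X -> Prop) :
  joint_measurable k -> measurable_fun setT w ->
  (forall x, 0 <= w x)%R -> (forall x y, 0 <= k x y)%R ->
  {ae mu, forall x, G x} -> (forall x, G x -> 0 < w x)%R ->
  (forall x y, G x -> G y -> (w x / w y <= k x y)%R) ->
  1 <= mixed_mean k.
Proof.
move=> mk mw w0 k0 aeG wG kw.
have mwV := measurable_fun_inv mw w0.
have waeG : {ae mu, forall x, (0 < w x)%R} by apply: (filterS _ aeG) => x; exact: wG.
set Y := mean Q (fun y => ((w y)^-1 `^ p')%:E).
have Y0 : 0 <= Y by apply: mean_ge0 => // x; exact: (power_ge0 (fun x => (w x)^-1)%R).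
have mwp := measurable_power p mw; have wp0 := power_ge0 w p.
have lower : mean Q (fun x => (w x `^ p)%:E) * Y `^ (p / p') <= mixed_mean k.
  rewrite muleC -(meanZl cQ _ mwp wp0) ?poweR_ge0//.
  apply: (mean_le cQ (measurable_funeM _ mwp) (measurable_dual_mean mk)).
  - by move=> x; rewrite mule_ge0 ?poweR_ge0.
  - by move=> x; exact: dual_mean_ge0.
  apply: (filterS _ aeG) => x Gx; rewrite /dual_mean.
  rewrite (_ : w x `^ p = (w x `^ p') `^ (p / p'))%R; last first.
    by rewrite -powRrM mulrC divfK// gt_eqF.
  rewrite -poweR_EFin muleC -poweRM// ?lee_fin ?powR_ge0//.
  apply: poweR_ler; [by rewrite ltW// divr_gt0|by rewrite mule_ge0 ?lee_fin ?powR_ge0|].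
  rewrite -(meanZl cQ (power_ge0 w p' x) (measurable_power p' mwV)
    (power_ge0 (fun x => (w x)^-1)%R p')).
  apply: (mean_le cQ).
  - exact: (measurable_funeM _ (measurable_power p' mwV)).
  - exact: (measurable_power p' (joint_measurable_section x mk)).
  - by move=> y; rewrite -EFinM lee_fin mulr_ge0 ?powR_ge0.
  - exact: power_ge0.
  apply: (filterS _ aeG) => y Gy; rewrite -EFinM lee_fin -powRM ?invr_ge0//.
  by rewrite ge0_ler_powR ?nnegrE ?divr_ge0 ?(ltW p'_gt0)//; exact: kw.
apply: le_trans lower.
have := mean_hoelder cQ p_gt0 p'_gt0 conj_pp' mw w0 waeG; rewrite -/Y => h.
have := poweR_ler (ltW p_gt0) _ h; rewrite poweR1r => /(_ lee01).
rewrite (poweRM _ (poweR_ge0 _ _) (poweR_ge0 _ _)) -!poweRrM.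
rewrite mulVf ?gt_eqF// poweRe1; last first.
  by apply: (mean_ge0 cQ) => x; exact: power_ge0.
by rewrite [(p'^-1 * p)%R]mulrC.
Qed.

End mixed_means.

(** * The triangular block weight *)

Section block_triangular.
Context (F : comNzRingType) (m : nat).
Implicit Types V U B : 'M[F]_m.

Lemma block_triangular_inverse V V' U U' B (s t : F) :
  V' *m V = 1%:M -> U' *m U = 1%:M -> t * s = 1 ->
  block_mx V' (t *: (B *m U')) 0 (t *: U') *m block_mx V (- (V *m B)) 0 (s *: U) =
  1%:M.
Proof.
move=> VV UU ts; rewrite mulmx_block !mulmx0 !mul0mx !addr0 add0r.
rewrite mulmxN mulmxA VV mul1mx -!scalemxAl -!scalemxAr !scalerA ts.
by rewrite !scale1r -mulmxA UU mulmx1 addNr -scalar_mx_block.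
Qed.

Lemma block_triangular_product V V' U U' B B' (s t : F) : s * t = 1 ->
  block_mx V (- (V *m B)) 0 (s *: U) *m block_mx V' (t *: (B' *m U')) 0 (t *: U') =
  block_mx (V *m V') (- (t *: (V *m (B - B') *m U'))) 0 (U *m U').
Proof.
move=> st; rewrite mulmx_block !mulmx0 !mul0mx !addr0 add0r; congr block_mx.
  rewrite -!scalemxAr -scalerDr -scalerN; congr (_ *: _).
  by rewrite mulmxBr mulmxBl !mulmxA mulNmx opprB.
by rewrite -scalemxAl -scalemxAr scalerA st scale1r.
Qed.

Lemma block_triangular_col V U B (s : F) (u w : 'cV[F]_m) :
  block_mx V (- (V *m B)) 0 (s *: U) *m col_mx u w =
  col_mx (- (V *m (B *m w - u))) (s *: (U *m w)).
Proof.
rewrite mul_block_col mul0mx add0r scalemxAl; congr col_mx.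
by rewrite mulmxBr opprB mulNmx mulmxA.
Qed.

End block_triangular.

Section block_weight.
Context {R : realType}.
Local Notation C := (R[i]%C).

Lemma mxnormN m n (A : 'M[C]_(m, n)) : mxnorm (- A) = mxnorm A.
Proof.
have le (D : 'M[C]_(m, n)) : mxnorm (- D) <= mxnorm D.
  apply: mxnorm_le; first exact: mxnorm_ge0.
  by move=> v; rewrite mulNmx enormN enorm_mulmx_le.
by have := le (- A); rewrite opprK => leN; apply: le_anti; rewrite le leN.
Qed.

(** The two exponents compose to [1 / 2]: the matrix on the left is the positive
    square root of the Gram matrix of [A], and so has the same Gram matrix as [A]. *)
Lemma enorm_gram_power n (A A' : 'M[C]_n) (p : R) v : p != 0 -> A' *m A = 1%:M ->
  enorm (mxpowR (mxpowR (map_mx Num.conj A^T *m A) (p / 2)) p^-1 *m v) =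
  enorm (A *m v).
Proof.
move=> p0 AA'; have pM := posdef_gram AA'; apply: enorm_mulmx_gram.
rewrite mxpowRM//; have -> : p / 2 * p^-1 = 2^-1 by field.
rewrite mxpowR_adjoint mxpowRD//; have -> : 2^-1 + 2^-1 = 1 :> R by field.
exact: mxpowR1.
Qed.

(** Both polar decompositions have unitary factors, which do not change the norm. *)
Lemma mxnorm_gram_power n (A A' D D' : 'M[C]_n) (p : R) : p != 0 ->
  A' *m A = 1%:M -> D' *m D = 1%:M ->
  mxnorm (mxpowR (mxpowR (map_mx Num.conj A^T *m A) (p / 2)) p^-1 *m
          mxpowR (mxpowR (map_mx Num.conj D^T *m D) (p / 2)) (- p^-1)) <=
  mxnorm (A *m D').
Proof.
move=> p0 AA' DD'; apply: mxnorm_le; first exact: mxnorm_ge0.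
set W := mxpowR (map_mx Num.conj D^T *m D) (p / 2).
have pW : posdefmx W by apply: mxpowR_posdef; exact: posdef_gram DD'.
move=> v; rewrite -mulmxA (enorm_gram_power _ p0 AA').
set K := mxpowR W (- p^-1).
have -> : A *m (K *m v) = A *m D' *m (D *m (K *m v)).
  by rewrite -mulmxA [D' *m _]mulmxA DD' mul1mx.
apply: (le_trans (enorm_mulmx_le _ _)).
rewrite -(enorm_gram_power (K *m v) p0 DD') -/W /K mulmxA.
by rewrite mxpowRK// mul1mx.
Qed.

Section triangular_factor.
Context (m : nat) (p lam : R).
Implicit Types V U B : 'M[C]_m.

(** The matrix [Phi] of the proof; a large [lam] makes the oscillation of [B]
    small against the blocks that come from [U] and [V]. *)
Definition triangular_factor V U B : 'M[C]_(m + m) :=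
  block_mx (mxpowR V p^-1) (- (mxpowR V p^-1 *m B))
           0 (lam%:C%C *: mxpowR U p^-1).

Definition triangular_inverse V U B : 'M[C]_(m + m) :=
  block_mx (mxpowR V (- p^-1)) (lam^-1%:C%C *: (B *m mxpowR U (- p^-1)))
           0 (lam^-1%:C%C *: mxpowR U (- p^-1)).

Hypothesis lam0 : lam != 0.

Lemma triangular_inverseK V U B : posdefmx V -> posdefmx U ->
  triangular_inverse V U B *m triangular_factor V U B = 1%:M.
Proof.
move=> pV pU; apply: block_triangular_inverse.
- exact: mxpowRNK.
- exact: mxpowRNK.
- by rewrite -rmorphM mulVf.
Qed.

Lemma triangular_product V U B V' U' B' :
  triangular_factor V U B *m triangular_inverse V' U' B' =
  block_mx (mxpowR V p^-1 *m mxpowR V' (- p^-1))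
    (- (lam^-1%:C%C *: (mxpowR V p^-1 *m (B - B') *m mxpowR U' (- p^-1))))
    0 (mxpowR U p^-1 *m mxpowR U' (- p^-1)).
Proof. by apply: block_triangular_product; rewrite -rmorphM mulfV. Qed.

End triangular_factor.

End block_weight.

Section matrix_weight_constants.
Context {R : realType} {d : nat}.
Local Notation C := (R[i]%C).
Local Notation X := (Rn R d).
Local Notation mu := (@leb R d).
Local Open Scope ereal_scope.

Lemma mxmeas_fst k n (A : X -> 'M[C]_(k, n)) : mxmeas A ->
  mxmeas (fun z : X * X => A z.1).
Proof.
move=> mA i j; have [rA iA] := mA i j.
by split; [exact: (measurableT_comp rA measurable_fst)|
           exact: (measurableT_comp iA measurable_fst)].
Qed.

Lemma mxmeas_snd k n (A : X -> 'M[C]_(k, n)) : mxmeas A ->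
  mxmeas (fun z : X * X => A z.2).
Proof.
move=> mA i j; have [rA iA] := mA i j.
by split; [exact: (measurableT_comp rA measurable_snd)|
           exact: (measurableT_comp iA measurable_snd)].
Qed.

Definition weight_kernel (p : R) n (W : X -> 'M[C]_n) (x y : X) : R :=
  mxnorm (mxpowR (W x) p^-1 *m mxpowR (W y) (- p^-1)).

Definition oscillation_kernel (p : R) n (V U B : X -> 'M[C]_n) (x y : X) : R :=
  mxnorm (mxpowR (V x) p^-1 *m (B x - B y) *m mxpowR (U y) (- p^-1)).

Lemma joint_measurable_weight_kernel p n (W : X -> 'M[C]_n) : matrix_weight W ->
  joint_measurable (weight_kernel p W).
Proof.
move=> wW; have mW s := mxmeas_mxpowR s wW.
exact: (measurable_mxnorm (mxmeasM (mxmeas_fst (mW _)) (mxmeas_snd (mW _)))).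
Qed.

Lemma joint_measurable_oscillation_kernel p n (V U B : X -> 'M[C]_n) :
  matrix_weight V -> matrix_weight U -> mxmeas B ->
  joint_measurable (oscillation_kernel p V U B).
Proof.
move=> wV wU mB.
have mV := mxmeas_fst (mxmeas_mxpowR p^-1 wV).
have mU := mxmeas_snd (mxmeas_mxpowR (- p^-1) wU).
have mBB := mxmeasD (mxmeas_fst mB) (mxmeasN (mxmeas_snd mB)).
exact: (measurable_mxnorm (mxmeasM (mxmeasM mV mBB) mU)).
Qed.

Lemma mixed_mean_le_Ap (p p' : R) Q n (W : X -> 'M[C]_n) : cubes Q ->
  mixed_mean p p' Q (weight_kernel p W) <= Ap_const p p' W.
Proof. by move=> cQ; apply: ereal_sup_ubound; exists Q. Qed.

(** For a fixed vector [e], the kernel of the weight is at least [w x / w y] with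
    [w x = |W(x)^{1/p} e|]. *)
Lemma Ap_const_ge1 p p' n (W : X -> 'M[C]_n) : (0 < n)%N -> (1 < p)%R ->
  (p^-1 + p'^-1 = 1)%R -> matrix_weight W -> 1 <= Ap_const p p' W.
Proof.
move=> n0 p1 pp' wW; have cQ := @unit_cube R d.
apply: le_trans (mixed_mean_le_Ap p p' W cQ).
pose e : 'cV[C]_n := delta_mx (Ordinal n0) ord0.
have e0 : e != 0%R.
  apply/eqP => /matrixP/(_ (Ordinal n0) ord0)/eqP.
  by rewrite !mxE !eqxx oner_eq0.
pose w x := enorm (mxpowR (W x) p^-1 *m e).
have recover x : posdefmx (W x) ->
    mxpowR (W x) (- p^-1) *m (mxpowR (W x) p^-1 *m e) = e.
  by move=> pW; rewrite mulmxA mxpowRNK// mul1mx.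
have wpos x : posdefmx (W x) -> (0 < w x)%R.
  move=> pW; rewrite enorm_gt0; apply: contra e0 => /eqP We0.
  by rewrite -(recover x pW) We0 mulmx0.
apply: (mixed_mean_ge1 cQ p1 pp' (joint_measurable_weight_kernel p wW) (w := w) _ _ _
  wW.2 wpos).
- exact: (measurable_enorm (mxmeasM (mxmeas_mxpowR p^-1 wW) (mxmeas_cst e))).
- by move=> x; exact: enorm_ge0.
- by move=> x y; exact: mxnorm_ge0.
move=> x y pWx pWy; rewrite ler_pdivrMr ?wpos//.
apply: le_trans (enorm_mulmx_le _ _).
by rewrite -mulmxA recover.
Qed.

Lemma fine_Ap_const p p' n (W : X -> 'M[C]_n) : (0 < n)%N -> (1 < p)%R ->
  (p^-1 + p'^-1 = 1)%R -> Ap_weight p p' W ->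
  (fine (Ap_const p p' W))%:E = Ap_const p p' W.
Proof.
move=> n0 p1 pp' [wW Woo]; apply: fineK; rewrite ge0_fin_numE; first exact: Woo.
exact: le_trans lee01 (Ap_const_ge1 n0 p1 pp' wW).
Qed.

Lemma Lp_norm_le p n n' (W : X -> 'M[C]_n) (W' : X -> 'M[C]_n')
    (f : X -> 'cV[C]_n) (f' : X -> 'cV[C]_n') (t : R) :
  (0 < p)%R -> (0 <= t)%R -> matrix_weight W -> matrix_weight W' ->
  mxmeas f -> mxmeas f' ->
  {ae mu, forall x, (enorm (mxpowR (W x) p^-1 *m f x) <=
                     t * enorm (mxpowR (W' x) p^-1 *m f' x))%R} ->
  Lp_norm p W f <= t%:E * Lp_norm p W' f'.
Proof.
move=> p0 t0 wW wW' mf mf' ff'.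
pose E n (w : X -> 'M[C]_n) (h : X -> 'cV[C]_n) x : \bar R :=
  (enorm (mxpowR (w x) p^-1 *m h x) `^ p)%:E.
have mE l (w : X -> 'M[C]_l) (h : X -> 'cV[C]_l) : matrix_weight w -> mxmeas h ->
    measurable_fun setT (E l w h).
  move=> ww mh; apply/measurable_EFinP.
  exact: (measurableT_comp (measurable_powR p)
    (measurable_enorm (mxmeasM (mxmeas_mxpowR p^-1 ww) mh))).
have E0 l (w : X -> 'M[C]_l) (h : X -> 'cV[C]_l) x : 0 <= E l w h x.
  by rewrite lee_fin powR_ge0.
have t1 : t%:E = (t `^ p)%:E `^ p^-1.
  by rewrite poweR_EFin -powRrM divff ?gt_eqF// powRr1.
have tp0 : 0 <= (t `^ p)%:E by rewrite lee_fin powR_ge0.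
have I0 l (w : X -> 'M[C]_l) (h : X -> 'cV[C]_l) : 0 <= \int[mu]_x E l w h x.
  by apply: integral_ge0 => x _; exact: E0.
rewrite /Lp_norm t1 -(poweRM _ tp0 (I0 _ _ _)).
apply: poweR_ler; [by rewrite invr_ge0 ltW|exact: I0|].
rewrite -(ge0_integralZl mu measurableT (mE _ _ _ wW' mf') (fun x _ => E0 _ _ _ x) tp0).
apply: (ae_ge0_le_integral measurableT (fun x _ => E0 _ _ _ x) (mE _ _ _ wW mf)).
- by move=> x _; rewrite mule_ge0.
- exact: (measurable_funeM _ (mE _ _ _ wW' mf')).
apply: filterS ff' => x h _; rewrite -EFinM lee_fin -(powRM _ t0 (enorm_ge0 _)).
by rewrite ge0_ler_powR ?nnegrE ?(ltW p0) ?mulr_ge0 ?enorm_ge0.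
Qed.

Lemma mixed_mean_le_BMO p p' Q m (V U B : X -> 'M[C]_m) (b : R) : cubes Q ->
  (0 < p)%R -> (0 <= b)%R -> BMO_norm p p' V U B <= b%:E ->
  mixed_mean p p' Q (oscillation_kernel p V U B) <= (b `^ p)%:E.
Proof.
move=> cQ p0 b0; rewrite /BMO_norm; set S := ereal_sup _ => Sb.
have QS : mixed_mean p p' Q (oscillation_kernel p V U B) <= S.
  by apply: ereal_sup_ubound; exists Q.
have S0 : 0 <= S by apply: le_trans QS; exact: mixed_mean_ge0.
apply: (le_trans QS).
have := poweR_ler (ltW p0) (poweR_ge0 _ _) Sb.
by rewrite -poweRrM mulVf ?gt_eqF// poweRe1// poweR_EFin.
Qed.

End matrix_weight_constants.

(** * The constant of the block weight and the commutator *)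

Section block_weight_bounds.
Context {R : realType} {d : nat}.
Local Notation C := (R[i]%C).
Local Notation X := (Rn R d).
Local Notation mu := (@leb R d).
Context (p p' : R) (m : nat) (U V B : X -> 'M[C]_m) (lam : R).
Hypotheses (p_gt1 : 1 < p) (conj_pp' : p^-1 + p'^-1 = 1) (m_gt0 : (0 < m)%N).
Hypotheses (aU : Ap_weight p p' U) (aV : Ap_weight p p' V) (mB : mxmeas B).
Hypotheses (lam_gt0 : 0 < lam).

Let p_gt0 : 0 < p := lt_trans ltr01 p_gt1.
Let p_neq0 : p != 0 := lt0r_neq0 p_gt0.
Let lam_neq0 : lam != 0 := lt0r_neq0 lam_gt0.

Let Phi x := triangular_factor p lam (V x) (U x) (B x).
Let Phi' x := triangular_inverse p lam (V x) (U x) (B x).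

Definition block_weight (x : X) : 'M[C]_(m + m) :=
  mxpowR (map_mx Num.conj (Phi x)^T *m Phi x) (p / 2).

Let regular x := posdefmx (U x) /\ posdefmx (V x).

Let ae_regular : {ae mu, forall x, regular x}.
Proof. by apply: filterS2 aU.1.2 aV.1.2 => x; split. Qed.

Let PhiK x : regular x -> Phi' x *m Phi x = 1%:M.
Proof. by move=> [pU pV]; exact: triangular_inverseK. Qed.

Let mxmeas_Phi : mxmeas Phi.
Proof.
have mV := mxmeas_mxpowR p^-1 aV.1; have mU := mxmeas_mxpowR p^-1 aU.1.
have mlU : mxmeas (fun x => lam%:C%C *: mxpowR (U x) p^-1).
  have := mxmeasM (mxmeas_cst (lam%:C%C)%:M) mU; congr mxmeas.
  by apply/funext => x; rewrite mul_scalar_mx.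
exact: (mxmeas_block mV (mxmeasN (mxmeasM mV mB)) (mxmeas_cst 0) mlU).
Qed.

Lemma block_weight_matrix_weight : matrix_weight block_weight.
Proof.
pose M x := map_mx Num.conj (Phi x)^T *m Phi x.
have wM : matrix_weight M.
  split; first exact: (mxmeasM (mxmeas_adjoint mxmeas_Phi) mxmeas_Phi).
  by apply: filterS ae_regular => x rx; exact: posdef_gram (PhiK rx).
split; first exact: (mxmeas_mxpowR (p / 2) wM).
by apply: filterS wM.2 => x px; exact: mxpowR_posdef.
Qed.

Local Open Scope ereal_scope.

Let block_kernel_le x y : regular x -> regular y ->
  (weight_kernel p block_weight x y ^+ 2 <= weight_kernel p V x y ^+ 2 +
    (lam^-1 * oscillation_kernel p V U B x y) ^+ 2 + weight_kernel p U x y ^+ 2)%R.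
Proof.
move=> rx ry.
have := mxnorm_gram_power p_neq0 (PhiK rx) (PhiK ry).
rewrite /Phi' triangular_product// => h.
apply: (@le_trans _ _ (mxnorm (block_mx (mxpowR (V x) p^-1 *m mxpowR (V y) (- p^-1))
    (- (lam^-1%:C%C *: (mxpowR (V x) p^-1 *m (B x - B y) *m mxpowR (U y) (- p^-1))))
    0 (mxpowR (U x) p^-1 *m mxpowR (U y) (- p^-1))) ^+ 2)%R).
  by rewrite ler_pXn2r ?nnegrE ?mxnorm_ge0.
apply: (le_trans (mxnorm_block_triangular _ _ _)); rewrite mxnormN.
rewrite lerD2r lerD2l.
rewrite ler_pXn2r ?nnegrE ?mulr_ge0 ?invr_ge0 ?mxnorm_ge0 ?(ltW lam_gt0)//.
by apply: mxnormZ; rewrite invr_ge0 ltW.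
Qed.

Let fineU := fine_Ap_const m_gt0 p_gt1 conj_pp' aU.
Let fineV := fine_Ap_const m_gt0 p_gt1 conj_pp' aV.

Let constant_le (s : R) : (2 <= s)%R ->
  (Num.max 1 (3 `^ (p - 2)) * (s + 1) <= 3 `^ (p / p') * s + 1)%R.
Proof.
move=> s2; rewrite (div_conjugate p_gt1 conj_pp').
have e : (3 `^ (p - 1) = 3 * 3 `^ (p - 2))%R.
  rewrite -{2}(@powRr1 _ 3%R)// -powRD; last by rewrite pnatr_eq0 implybT.
  by congr (_ `^ _)%R; ring.
have q1 : (1 <= 3 `^ (p - 1))%R.
  rewrite -[X in (X <= _)%R](powRr0 3%R) ler_powR//; last by rewrite subr_ge0 ltW.
  by rewrite ler1n.
have r0 : (0 <= 3 `^ (p - 2))%R := powR_ge0 _ _.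
move: e q1 r0; move: (3 `^ (p - 1))%R (3 `^ (p - 2))%R => a b ->.
have [_|_] := leP 1%R b => *; nra.
Qed.

(** The summand 1 is the contribution of the oscillation of [B], normalised by
    [lam]; the factor in front of it is absorbed by the other two summands, since
    the constants of [U] and [V] are at least 1. *)
Lemma Ap_const_block_weight : BMO_norm p p' V U B <= lam%:E ->
  Ap_const p p' block_weight <=
  (3 `^ (p / p') * (fine (Ap_const p p' U) + fine (Ap_const p p' V)) + 1)%:E.
Proof.
move=> Blam; apply: ge_ereal_sup => _ [Q cQ <-].
rewrite -[leLHS]/(mixed_mean p p' Q (weight_kernel p block_weight)).
have jB := joint_measurable_oscillation_kernel p aV.1 aU.1 mB.
have lamV0 : (0 <= lam^-1)%R by rewrite invr_ge0 ltW.
have o0 x y : (0 <= oscillation_kernel p V U B x y)%R by exact: mxnorm_ge0.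
have jlB : joint_measurable (fun x y => lam^-1 * oscillation_kernel p V U B x y)%R.
  exact: (measurable_funM (measurable_cst _) jB).
have k0 n (W : X -> 'M[C]_n) x y : (0 <= weight_kernel p W x y)%R by exact: mxnorm_ge0.
apply: (le_trans (mixed_mean_pythagoras cQ p_gt1 conj_pp'
  (joint_measurable_weight_kernel p aV.1) jlB
  (joint_measurable_weight_kernel p aU.1)
  (joint_measurable_weight_kernel p block_weight_matrix_weight)
  (k0 _ V) (fun x y => mulr_ge0 lamV0 (o0 x y)) (k0 _ U) (k0 _ block_weight)
  ae_regular block_kernel_le)).
have osc :
    mixed_mean p p' Q (fun x y => lam^-1 * oscillation_kernel p V U B x y)%R <= 1.
  rewrite (mixed_meanZ cQ p_gt1 conj_pp' lamV0 jB o0).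
  have := mixed_mean_le_BMO cQ p_gt0 (ltW lam_gt0) Blam.
  have t0 : 0 <= (lam^-1 `^ p)%:E :> \bar R by rewrite lee_fin powR_ge0.
  move=> /(lee_wpmul2l t0) /le_trans; apply.
  by rewrite -EFinM -powRM ?invr_ge0 ?(ltW lam_gt0)// mulVf// powR1.
have UV2 : (2 <= fine (Ap_const p p' U) + fine (Ap_const p p' V))%R.
  apply: lerD.
    by rewrite -lee_fin fineU; exact: (Ap_const_ge1 m_gt0 p_gt1 conj_pp' aU.1).
  by rewrite -lee_fin fineV; exact: (Ap_const_ge1 m_gt0 p_gt1 conj_pp' aV.1).
apply: (@le_trans _ _ (Num.max 1 (3 `^ (p - 2)) *
  (fine (Ap_const p p' U) + fine (Ap_const p p' V) + 1))%:E); last first.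
  by rewrite lee_fin constant_le.
rewrite EFinM; apply: lee_wpmul2l; first by rewrite lee_fin le_max ler01.
have sumE (u v : R) (a b : \bar R) : u%:E = a -> v%:E = b ->
    (u + v + 1)%:E = b + 1 + a.
  by move=> <- <-; rewrite -!EFinD; congr EFin; ring.
rewrite (sumE _ _ _ _ fineU fineV).
exact: (leeD (leeD (mixed_mean_le_Ap p p' V cQ) osc) (mixed_mean_le_Ap p p' U cQ)).
Qed.

Let enorm_block_weight x (v : 'cV[C]_(m + m)) : regular x ->
  enorm (mxpowR (block_weight x) p^-1 *m v) = enorm (Phi x *m v).
Proof. by move=> rx; exact: (enorm_gram_power v p_neq0 (PhiK rx)). Qed.

Let lift (f : X -> 'cV[C]_m) (x : X) : 'cV[C]_(m + m) := col_mx (B x *m f x) (f x).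

Let enorm_lift f x : regular x ->
  enorm (mxpowR (block_weight x) p^-1 *m lift f x) =
  (lam * enorm (mxpowR (U x) p^-1 *m f x))%R.
Proof.
move=> rx; rewrite enorm_block_weight//.
rewrite -[lift f x]/(col_mx _ _) block_triangular_col subrr mulmx0 oppr0.
apply/eqP; rewrite -(@eqrXn2 _ 2)// ?mulr_ge0 ?enorm_ge0 ?(ltW lam_gt0)//.
rewrite enorm_col_mx enorm0 expr0n add0r enormZ normc_real//.
exact: ltW.
Qed.

Lemma vext_lift (T : (X -> C) -> X -> C) f x :
  vext T (lift f) x = col_mx (vext T (mulop B f) x) (vext T f x).
Proof.
apply/matrixP => i j; rewrite mxE; case: (split_ordP i) => l ->.
  rewrite col_mxEu mxE; congr (T _ x); apply/funext => y.
  by rewrite col_mxEu.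
rewrite col_mxEd mxE; congr (T _ x); apply/funext => y.
by rewrite col_mxEd.
Qed.

(** The operator on [L^p(W)] is tested on the pairs [(B f, f)], whose norm is [lam]
    times that of [f]. *)
Lemma commutator_bound (dom : set (X -> C)) (T : (X -> C) -> X -> C) (c : R) :
  (0 <= c)%R ->
  (forall f, Lp_space p block_weight f ->
    [/\ vext_dom dom f, Lp_space p block_weight (vext T f) &
        Lp_norm p block_weight (vext T f) <= c%:E * Lp_norm p block_weight f]) ->
  forall f, Lp_space p U f ->
    [/\ commutator_dom B (vext_dom dom) f, Lp_space p V (commutator B (vext T) f) &
        Lp_norm p V (commutator B (vext T) f) <= (c * lam)%:E * Lp_norm p U f].
Proof.
move=> c0 Tc f [mf foo]; have wW := block_weight_matrix_weight.
have mF : mxmeas (lift f) := mxmeas_col_mx (mxmeasM mB mf) mf.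
have Ff : Lp_norm p block_weight (lift f) <= lam%:E * Lp_norm p U f.
  apply: (Lp_norm_le p_gt0 (ltW lam_gt0) wW aU.1 mF mf).
  by apply: filterS ae_regular => x rx; rewrite enorm_lift.
have LF : Lp_space p block_weight (lift f).
  split; first exact: mF.
  by apply: (le_lt_trans Ff); apply: lte_mul_pinfty => //; rewrite lee_fin ltW.
have [dF [mTF TFoo] TFF] := Tc _ LF.
have mTf : mxmeas (vext T f).
  have := mxmeas_dsubmx mTF; congr mxmeas; apply/funext => x.
  by rewrite vext_lift col_mxKd.
have mTBf : mxmeas (vext T (mulop B f)).
  have := mxmeas_usubmx mTF; congr mxmeas; apply/funext => x.
  by rewrite vext_lift col_mxKu.
have mS : mxmeas (commutator B (vext T) f) := mxmeasD (mxmeasM mB mTf) (mxmeasN mTBf).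
have SF : Lp_norm p V (commutator B (vext T) f) <=
    Lp_norm p block_weight (vext T (lift f)).
  rewrite -[leRHS]mul1e; apply: (Lp_norm_le p_gt0 ler01 aV.1 wW mS mTF).
  apply: filterS ae_regular => x rx; rewrite mul1r enorm_block_weight// vext_lift.
  rewrite block_triangular_col -(@ler_pXn2r _ 2)// ?nnegrE ?enorm_ge0//.
  by rewrite enorm_col_mx enormN lerDl sqr_ge0.
split.
- split=> i; first by have := dF (rshift m i); under eq_fun do rewrite col_mxEd.
  by have := dF (lshift m i); under eq_fun do rewrite col_mxEu.
- by split; [exact: mS|exact: le_lt_trans SF TFoo].
apply: (le_trans SF); apply: (le_trans TFF); rewrite EFinM -muleA.
have cE : 0 <= c%:E by rewrite lee_fin.
exact: (lee_wpmul2l cE Ff).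
Qed.

End block_weight_bounds.

Lemma Lp_opnorm_commutator_le (R : realType) (d : nat) (p p' : R)
    (dom : set (Rn R d -> R[i]%C)) (T : (Rn R d -> R[i]%C) -> Rn R d -> R[i]%C)
    (m : nat) (U V B : Rn R d -> 'M[R[i]%C]_m) (lam : R)
    (W := block_weight p U V B lam) :
  1 < p -> p^-1 + p'^-1 = 1 -> Ap_weight p p' U -> Ap_weight p p' V -> mxmeas B ->
  0 < lam ->
  (Lp_opnorm p U V (commutator_dom B (vext_dom dom)) (commutator B (vext T)) <=
   lam%:E * Lp_opnorm p W W (@vext_dom _ _ (m + m) dom) (vext T))%E.
Proof.
move=> p1 pp' aU aV mB lam0; rewrite -lee_pdivrMl//.
apply: le_ereal_inf_tmp => _ [c [c0 Tc] <-]; rewrite lee_pdivrMl//.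
apply: ereal_inf_lbound; exists (c * lam); last by rewrite mulrC EFinM.
split; first by rewrite mulr_ge0// ltW.
exact: (commutator_bound p1 aU aV mB lam0 c0 Tc).
Qed.

Unset Implicit Arguments.

Theorem lemma1p3 (R : realType) (d : nat) (p p' : R)
    (dom : set (Rn R d -> R[i]%C))
    (T : (Rn R d -> R[i]%C) -> Rn R d -> R[i]%C)
    (phi : nat -> R -> R)
    (m : nat) (U V B : Rn R d -> 'M[R[i]%C]_m) :
  (0 < d)%N ->
  1 < p -> p^-1 + p'^-1 = 1 ->
  linear_operator dom T ->
  (forall n, (0 < n)%N ->
    (forall t, 0 <= t -> 0 < phi n t) /\
    (forall s t, 0 <= s -> s <= t -> phi n s <= phi n t)) ->
  (forall n, (0 < n)%N -> forall W : Rn R d -> 'M[R[i]%C]_n,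
    Ap_weight p p' W ->
    (Lp_opnorm p W W (@vext_dom _ _ n dom) (vext T)
       <= (phi n (fine (Ap_const p p' W)))%:E)%E) ->
  (0 < m)%N ->
  Ap_weight p p' U -> Ap_weight p p' V ->
  mx_locally_integrable B ->
  (Lp_opnorm p U V (commutator_dom B (vext_dom dom)) (commutator B (vext T))
     <= BMO_norm p p' V U B *
        (phi (2 * m)%N
           (3 `^ (p / p') *
              (fine (Ap_const p p' U) + fine (Ap_const p p' V)) + 1))%:E)%E.
Proof.
move=> _ p1 pp' _ phiP T_bounded m0 aU aV [mB _].
rewrite mul2n -addnn; have mm0 : (0 < m + m)%N by rewrite addn_gt0 m0.
have [phi_gt0 phi_mono] := phiP _ mm0.
have U1 := Ap_const_ge1 m0 p1 pp' aU.1; have V1 := Ap_const_ge1 m0 p1 pp' aV.1.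
set A := (3 `^ (p / p') * _ + 1).
have A0 : 0 <= A.
  apply: addr_ge0; last exact: ler01.
  apply: mulr_ge0; first exact: powR_ge0.
  by apply: addr_ge0; apply: fine_ge0;
    [exact: le_trans lee01 U1|exact: le_trans lee01 V1].
have phiA0 := phi_gt0 _ A0.
have bound lam : 0 < lam -> (BMO_norm p p' V U B <= lam%:E)%E ->
    (Lp_opnorm p U V (commutator_dom B (vext_dom dom)) (commutator B (vext T)) <=
     (lam * phi (m + m)%N A)%:E)%E.
  move=> lam0 Blam; pose W := block_weight p U V B lam.
  have WA := Ap_const_block_weight p1 pp' m0 aU aV mB lam0 Blam.
  have aW : Ap_weight p p' W.
    split; first exact: (block_weight_matrix_weight aU aV mB lam0).
    exact: le_lt_trans WA (ltry _).
  have WE := fine_Ap_const mm0 p1 pp' aW.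
  have W0 : 0 <= fine (Ap_const p p' W).
    by apply: fine_ge0; exact: le_trans lee01 (Ap_const_ge1 mm0 p1 pp' aW.1).
  apply: (le_trans (Lp_opnorm_commutator_le dom T p1 pp' aU aV mB lam0)).
  have lamE : (0 <= lam%:E)%E by rewrite lee_fin ltW.
  rewrite EFinM; apply: (lee_wpmul2l lamE); apply: (le_trans (T_bounded _ mm0 W aW)).
  by rewrite lee_fin; apply: phi_mono W0 _; rewrite -lee_fin WE.
have : (0 <= BMO_norm p p' V U B)%E by exact: poweR_ge0.
case BE : (BMO_norm p p' V U B) => [b| |//] b0; last first.
  by rewrite gt0_mulye ?leey// lte_fin.
(* The oscillation norm [b] may vanish, whereas [lam] must be positive. *)
apply/lee_addgt0Pr => e e0.
have lam0 : 0 < b + e / phi (m + m)%N A.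
  by rewrite ltr_wpDl// ?divr_gt0// -lee_fin.
apply: (le_trans (bound _ lam0 _)).
  by rewrite BE lee_fin lerDl divr_ge0// ltW.
by rewrite -EFinM -EFinD lee_fin mulrDl divfK// gt_eqF.
Qed.
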